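(* Let $T>0$. The general solution, in the class $\mathcal C$, of the functional equation $$F(t,X)\,F(t,Y)=F(t,\,X+Y+\langle X,Y\rangle)\qquad\text{for all } X,Y\in\mathcal S$$ is of the form $$F(t,X)=\exp\Big\{\int_0^t \mathcal K(t,s)\,d\big(X_s-\tfrac12\langle X\rangle_s\big)\Big\},\qquad X\in\mathcal S,$$ where $(\mathcal K(t,s),\ s\ge 0,\ t\ge 0)$ is a deterministic function with $\mathcal K(t,s)=0$ for $t\le s$, such that i) $\mathcal K(t,\cdot)$ is càdlàg and has finite variation, for each $t\in[0,T]$; ii) $\int_0^T\omega_s\,\mathcal K(\cdot,ds)$ (that is, the function $t\mapsto\int_0^T\omega_s\,\mathcal K(t,ds)$) is continuous, for each $\omega\in C[0,T]$.
   Context: A complete probability space $(\Omega,\mathcal F,P)$ with a filtration satisfying the usual conditions of right-continuity and completeness is fixed. $\mathcal S$ is the class of continuous semimartingales $X$ vanishing at $0$; $\langle X\rangle$ is the square characteristic (quadratic variation) of the martingale part of $X$, and $\langle X,Y\rangle$ is the mutual characteristic of $X$ and $Y$. $C[0,T]$ is the space of continuous real functions on $[0,T]$. A mapping $h:[0,T]\times C[0,T]\to\mathbb R$ is non-anticipative if for all $\omega,\omega'\in C[0,T]$ and $t\in[0,T]$ one has $h(t,\omega)=h(t,\omega')$ whenever $\omega_s=\omega'_s$ for all $s\le t$. The class $\mathcal C$ consists of the functionals $F$ on $[0,T]\times\mathcal S$ of the form $F(t,X)=e^{h(t,\,X-\frac12\langle X\rangle)}$, $X\in\mathcal S$, for some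 continuous, non-anticipative functional $h(t,\omega)$ (here $h$ is evaluated along the paths of $X-\frac12\langle X\rangle$). For fixed $t$, $\mathcal K(t,ds)$ denotes Stieltjes integration with respect to the finite variation function $s\mapsto\mathcal K(t,s)$. *)

(* Defs.v *)
(* MathComp-Analysis. *)
From HB Require Import structures.
From mathcomp Require Import all_boot all_order all_algebra.
From mathcomp Require Import all_classical all_reals all_analysis.
Set Implicit Arguments.
Unset Strict Implicit.
Unset Printing Implicit Defensive.
Import Order.TTheory GRing.Theory Num.Theory.
Import numFieldNormedType.Exports.
Local Open Scope classical_set_scope.
Local Open Scope ring_scope.

Section partitions.
Context {R : realType}.
Implicit Types (a b : R) (s : seq R).

(* The i-th point of a = s_0 < s_1 < ... < s_(size s) = b; the list s itself
   omits the left endpoint, as in itv_partition. *)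
Definition ppt a b s (i : nat) : R := nth b (a :: s) i.

Definition fine_partition a b (delta : R) s : Prop :=
  itv_partition a b s /\
  forall i, (i < size s)%N -> ppt a b s i.+1 - ppt a b s i < delta.

(* Riemann-Stieltjes integral of f against g over ]a, b], with arbitrary tags;
   it exists when f is continuous and g has bounded variation. *)
Definition is_RS_int (f g : R -> R) a b (I : R) : Prop :=
  forall e : R, 0 < e -> exists2 delta : R, 0 < delta &
    forall s (z : nat -> R), fine_partition a b delta s ->
      (forall i, (i < size s)%N -> ppt a b s i <= z i <= ppt a b s i.+1) ->
      `| \sum_(0 <= i < size s)
           f (z i) * (g (ppt a b s i.+1) - g (ppt a b s i)) - I | < e.

Definition RS_int (f g : R -> R) a b : R := xget 0 (is_RS_int f g a b).

(* Integral over the closed interval [0, T] against the signed measure whose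
   distribution function is g, that is with the convention g(0-) = 0.  The atom
   g(0) at the origin cannot be dropped: for K(t, s) = 1_(s < t), which gives
   F(t, X) = exp(X_t - <X>_t / 2), the integral of w against K(t, ds) is
   w_0 - w_t with the atom, but over ]0, T] it would be - w_t for t > 0 and 0
   for t = 0, which is discontinuous when w_0 <> 0. *)
Definition stieltjes_int (T : R) (f g : R -> R) : R :=
  f 0 * g 0 + RS_int f g 0 T.

End partitions.

Section stochastic.
Context {R : realType} {d : measure_display} {Omega : measurableType d}.
Variables (P : probability Omega R) (Fil : R -> set (set Omega)).

(* Time is [0, +oo[: only the values at nonnegative times are ever used. *)
Definition process : Type := R -> Omega -> R.

Definition usual_filtration : Prop :=
  [/\ forall t, 0 <= t -> sigma_algebra setT (Fil t) /\ Fil t `<=` measurable,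
      forall s t, 0 <= s -> s <= t -> Fil s `<=` Fil t,
      forall t, 0 <= t -> Fil t = \bigcap_(u in [set u | t < u]) Fil u &
      P.-negligible `<=` Fil 0].

Definition adapted (X : process) : Prop :=
  forall t, 0 <= t -> forall B : set R, measurable B -> Fil t (X t @^-1` B).

Definition continuous_paths (X : process) : Prop :=
  forall w, {within `[0, +oo[, continuous (X ^~ w)}.

(* The last clause is E[M_t | Fil_s] = M_s. *)
Definition martingale (M : process) : Prop :=
  [/\ adapted M,
      forall t, 0 <= t -> P.-integrable setT (EFin \o M t) &
      forall s t, 0 <= s -> s <= t -> forall A, Fil s A ->
        (\int[P]_(w in A) (M t w)%:E = \int[P]_(w in A) (M s w)%:E)%E].

Definition stopping_time (tau : Omega -> \bar R) : Prop :=
  (forall w, (0 <= tau w)%E) /\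
  forall t, 0 <= t -> Fil t [set w | (tau w <= t%:E)%E].

Definition stopped (M : process) (tau : Omega -> \bar R) : process :=
  fun t w => M (fine (Order.min t%:E (tau w))) w.

Definition continuous_local_martingale0 (M : process) : Prop :=
  [/\ adapted M, continuous_paths M, forall w, M 0 w = 0 &
      exists tau : nat -> Omega -> \bar R,
      [/\ forall n, stopping_time (tau n),
          forall n w, (tau n w <= tau n.+1 w)%E,
          {ae P, forall w, tau ^~ w @ \oo --> +oo%E} &
          forall n, martingale (stopped M (tau n))]].

Definition continuous_FV0 (A : process) : Prop :=
  [/\ adapted A, continuous_paths A, forall w, A 0 w = 0 &
      forall t w, 0 <= t -> bounded_variation 0 t (A ^~ w)].

Definition decomposition (X M A : process) : Prop :=
  [/\ continuous_local_martingale0 M, continuous_FV0 A &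
      forall t w, 0 <= t -> X t w = M t w + A t w].

(* The class S. *)
Definition continuous_semimartingale0 (X : process) : Prop :=
  exists M A, decomposition X M A.

(* S_s --> I in probability as the mesh of the partition s of [0, t] tends
   to 0. *)
Definition cvg_proba_mesh (t : R) (S : seq R -> Omega -> R) (I : Omega -> R) :
    Prop :=
  forall e : R, 0 < e -> exists2 delta : R, 0 < delta &
    forall s, fine_partition 0 t delta s ->
      (P [set w | (e <= `|S s w - I w|)%R] < e%:E)%E.

Definition sum_squares (M : process) (t : R) (s : seq R) : Omega -> R :=
  fun w => \sum_(0 <= i < size s)
             (M (ppt 0 t s i.+1) w - M (ppt 0 t s i) w) ^+ 2.

Definition is_bracket (X Q : process) : Prop :=
  [/\ adapted Q, continuous_paths Q, forall w, Q 0 w = 0,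
      forall s t w, 0 <= s -> s <= t -> Q s w <= Q t w &
      exists M A, decomposition X M A /\
        forall t, 0 <= t -> cvg_proba_mesh t (sum_squares M t) (Q t)].

(* <X>, the quadratic variation of the martingale part of X, which is
   determined up to indistinguishability; here a version is chosen. *)
Definition bracket (X : process) : process :=
  xget (fun _ _ => 0) (is_bracket X).

(* <X, Y>, by polarization. *)
Definition cobracket (X Y : process) : process :=
  fun t w => 2^-1 * (bracket (fun u v => X u v + Y u v) t w
                     - bracket X t w - bracket Y t w).

(* The stochastic integral over [0, t] of a process H with respect to X, as the
   limit in probability of the sums over the left endpoints.  For an adapted
   cadlag H and a continuous semimartingale X the limit exists and is the Ito
   integral of H (equivalently of its left-continuous modification, X being
   continuous). *)
Definition ito_sum (H X : process) (t : R) (s : seq R) : Omega -> R :=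
  fun w => \sum_(0 <= i < size s)
    H (ppt 0 t s i) w * (X (ppt 0 t s i.+1) w - X (ppt 0 t s i) w).

Definition stoch_int (H X : process) (t : R) : Omega -> R :=
  xget (fun=> 0) [set I : Omega -> R |
    measurable_fun setT I /\ cvg_proba_mesh t (ito_sum H X t) I].

(* X - <X> / 2 *)
Definition compensated (X : process) : process :=
  fun t w => X t w - 2^-1 * bracket X t w.

(* A functional on [0, T] x S; its values on other arguments are immaterial. *)
Definition functional : Type := R -> process -> Omega -> R.

Definition functional_equation (T : R) (F : functional) : Prop :=
  forall X Y, continuous_semimartingale0 X -> continuous_semimartingale0 Y ->
  forall t, 0 <= t <= T ->
    {ae P, forall w,
       F t X w * F t Y w =
       F t (fun u v => X u v + Y u v + cobracket X Y u v) w}.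

End stochastic.

Section path_functionals.
Context {R : realType}.
Variable T : R.

(* Elements of C[0, T] are represented by functions R -> R continuous on
   [0, T]; their values outside [0, T] are arbitrary, and ignored by the
   topology of {uniform` `[0, T] -> R} and by non-anticipative functionals. *)
Definition C0T : set (R -> R) := [set x | {within `[0, T], continuous x}].

Definition non_anticipative (h : R -> (R -> R) -> R) : Prop :=
  forall x y t, C0T x -> C0T y -> 0 <= t <= T ->
    (forall s, 0 <= s <= t -> x s = y s) -> h t x = h t y.

Definition continuous_path_functional (h : R -> (R -> R) -> R) : Prop :=
  {within `[0, T] `*` (C0T : set {uniform` `[0, T] -> R}),
     continuous (fun p : R * {uniform` `[0, T] -> R} => h p.1 p.2)}.

Definition cadlag (g : R -> R) : Prop :=
  (forall s, 0 <= s -> g u @[u --> s^'+] --> g s) /\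
  (forall s, 0 < s -> cvg (g u @[u --> s^'-])).

(* As K t vanishes on [t, +oo[, finite variation on [0, T] is the same as on
   [0, +oo[. *)
Definition admissible_kernel (K : R -> R -> R) : Prop :=
  [/\ forall t s, 0 <= t -> t <= s -> K t s = 0,
      forall t, 0 <= t <= T -> cadlag (K t) /\ bounded_variation 0 T (K t) &
      forall x, C0T x ->
        {within `[0, T], continuous (fun t => stieltjes_int T x (K t))}].

End path_functionals.

Section class_C.
Context {R : realType} {d : measure_display} {Omega : measurableType d}.
Variables (P : probability Omega R) (Fil : R -> set (set Omega)).

Definition class_C (T : R) (F : @functional R d Omega) : Prop :=
  exists h : R -> (R -> R) -> R,
    [/\ continuous_path_functional T h, non_anticipative T h &
        forall X, continuous_semimartingale0 P Fil X ->
        forall t, 0 <= t <= T ->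
          {ae P, forall w,
             F t X w = expR (h t (fun s => compensated P Fil X s w))}].

Definition exp_integral_form (T : R) (K : R -> R -> R)
    (F : @functional R d Omega) : Prop :=
  forall X, continuous_semimartingale0 P Fil X ->
  forall t, 0 <= t <= T ->
    {ae P, forall w,
       F t X w = expR (stoch_int P (fun s _ => K t s) (compensated P Fil X) t w)}.

End class_C.

(* Main.v *)
(* Deterministic paths of finite variation are semimartingales with vanishing
   bracket, so the functional equation makes h(t, .) additive on them, hence, by
   density and continuity, a continuous linear form L on the paths of C[0, T]
   vanishing at 0.  Such a form is x |-> - \int x dK, with K(s) the limit of L along
   ramps increasing to the indicator of ]s, T]: stacking functions with disjoint
   supports shows that the limit exists and that K is right-continuous, and
   recombining increments with signs bounds its variation.  Integrating by parts
   path by path, - \int V dK is the stochastic integral of K against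
   V = X - <X>/2, the sums converging for every path.
   Conversely, the linear forms x |-> \int x dK(t, .) are uniformly bounded in t by
   the principle of uniform boundedness, whence the joint continuity of h.  The
   functional equation then reduces to the additivity of compensation,
   Z - <Z>/2 = (X - <X>/2) + (Y - <Y>/2) for Z = X + Y + <X, Y>, which holds because
   adding a continuous process of finite variation does not change the bracket.
   That X + Y is again a semimartingale requires optional stopping: a continuous
   martingale is stopped along refining grids of deterministic times, and the
   stopped variables are uniformly integrable. *)
Require Import Defs.
From mathcomp Require Import all_boot all_order all_algebra.
From mathcomp Require Import all_classical all_reals all_analysis.
From mathcomp Require Import measurable_realfun ring lra.
Import Order.TTheory GRing.Theory Num.Theory.
Import numFieldNormedType.Exports.
Set Implicit Arguments.
Unset Strict Implicit.
Unset Printing Implicit Defensive.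
Local Open Scope classical_set_scope.
Local Open Scope ring_scope.

(** * Riemann-Stieltjes sums *)

(** The functional equation tests [h] only on paths starting from 0, so the linear form lives on
    [C00], and a general path x enters through x - x 0. As the kernel vanishes at T, constants
    integrate to 0 once the atom at the origin is counted. Hence the integral of x against K(t, ds)
    is - h(t, x - x 0), and condition ii) follows from the continuity of h. The minus sign arises
    because K(t, s) is the mass of ]s, T] and not of [0, s].

    Brackets and stochastic integrals are chosen by [xget] and controlled only up to null sets. Two
    devices deal with this. Since [h] is deterministic, an almost sure equation about deterministic
    paths can be read at a single sample point. And adding a process of finite variation leaves the
    set of all brackets unchanged, so the chosen version is literally the same and compensation is
    additive at every sample point.

    The equation gives additivity alone; real multiples come from boundedness near 0. *)

Section continuity.
Context {R : realType}.
Implicit Types (A : set R) (f : R -> R) (a b : R).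

Lemma within_continuousP A f :
  {within A, continuous f} <->
  forall x, A x -> forall e : R, 0 < e -> exists2 d : R, 0 < d &
    forall y, A y -> `|x - y| < d -> `|f x - f y| < e.
Proof.
rewrite subspace_continuousP; split=> H x Ax.
  move=> e e0; have /cvgrPdist_lt/(_ e e0) := H x Ax.
  rewrite near_withinE => /nbhs_ballP[d d0 dP].
  by exists d => // y Ay xy; apply: dP.
apply/cvgrPdist_lt => e e0; have [d d0 dP] := H x Ax e e0.
rewrite near_withinE; apply/nbhs_ballP; exists d => // y xy Ay; exact: dP.
Qed.

Lemma segment_unif_continuous a b f : {within `[a, b], continuous f} ->
  forall e : R, 0 < e -> exists2 d : R, 0 < d &
    forall x y, a <= x <= b -> a <= y <= b -> `|x - y| < d -> `|f x - f y| < e.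
Proof.
move=> /within_continuousP fc e e0.
have /compact_near_coveringP/near_covering_withinP cov := @segment_compact R a b.
(* Compactness in its near-covering form: [P d] holds around each point for all small [d], hence for
   one [d] on the whole segment. *)
pose P (d x : R) := forall y : R, a <= y <= b -> `|x - y| < d -> `|f x - f y| < e.
have /cov : forall x, `[a, b]%classic x ->
    \forall x' \near x & d \near 0^'+, `[a, b]%classic x' -> P d x'.
  move=> x xab; have [d d0 dP] := fc x xab (e / 2) ltac:(lra).
  exists (ball x (d / 2), [set i | i < d / 2]).
    split; first by apply: nbhsx_ballx; lra.
    by apply: nbhs_right_lt; lra.
  move=> [x' d'] /= [xx' d'd] x'ab y yab x'y.
  have xx'f : `|f x - f x'| < e / 2.
    by apply: dP => //; move: xx'; rewrite /ball/=; lra.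
  have xyf : `|f x - f y| < e / 2.
    apply: dP => //.
    rewrite (_ : x - y = (x - x') + (x' - y)); last by ring.
    by rewrite (le_lt_trans (ler_normD _ _))//; move: xx'; rewrite /ball/=; lra.
  rewrite (_ : f x' - f y = - (f x - f x') + (f x - f y)); last by ring.
  by rewrite (le_lt_trans (ler_normD _ _))// normrN; lra.
move=> dP; have : \forall d \near 0^'+, 0 < d /\ `[a, b]%classic `<=` P d.
  by near=> d; split=> //; near: d; exact: dP.
move=> /filter_ex[d [d0 {}dP]]; exists d => // x y xab yab xy.
by apply: dP => //=; rewrite ?in_itv.
Unshelve. all: by end_near. Qed.

Lemma segment_continuous_bounded a b f : {within `[a, b], continuous f} ->
  exists2 M : R, 0 <= M & forall x, a <= x <= b -> `|f x| <= M.
Proof.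
move=> fc; have [ab|ba] := leP a b; last first.
  by exists 0 => // x /andP[ax xb]; have := le_trans ax xb; rewrite leNgt ba.
have /within_continuousP nfc : {within `[a, b], continuous f} := fc.
have {}nfc : {within `[a, b], continuous (fun x => `|f x|)}.
  apply/within_continuousP => x xab e e0; have [d d0 dP] := nfc x xab e e0.
  by exists d => // y yab xy; rewrite (le_lt_trans (ler_dist_dist _ _))// dP.
have [c cab cP] := EVT_max ab nfc.
by exists `|f c| => // x xab; apply: cP; rewrite ?in_itv.
Qed.

End continuity.

Section RS_sums.
Context {R : realType}.
Implicit Types (f g V : R -> R) (a b : R) (s : seq R) (c : nat -> R).

(** Coefficients are attached to cells instead of being values at tags, so that tagged sums, Ito
    sums and sums of squares (where [c i] is itself an increment) are all instances. *)
Definition rs_sum c g a b s : R :=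
  \sum_(0 <= i < size s) c i * (g (ppt a b s i.+1) - g (ppt a b s i)).

Lemma rs_sum_cons c g a b x s :
  rs_sum c g a b (x :: s) =
  c 0%N * (g x - g a) + rs_sum (fun i => c i.+1) g x b s.
Proof. by rewrite /rs_sum /= big_nat_recl. Qed.

(* In practice [V] is the total variation of [g]. *)
Definition dominates a b V g := forall x y, a <= x -> x <= y -> y <= b ->
  `|g y - g x| <= V y - V x.

Lemma dominatesW a b V g x : a <= x -> dominates a b V g -> dominates x b V g.
Proof. by move=> ax H u v xu uv vb; apply: H => //; exact: le_trans xu. Qed.

Lemma dominates_le a b V g : dominates a b V g ->
  forall x y, a <= x -> x <= y -> y <= b -> V x <= V y.
Proof. by move=> H x y ax xy yb; have := H _ _ ax xy yb;
  move=> /(le_trans (normr_ge0 _)); rewrite subr_ge0. Qed.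

Lemma bounded_variation_dominated a b g : a <= b -> bounded_variation a b g ->
  exists V, dominates a b V g.
Proof.
move=> ab bvg; exists (fun x => fine (total_variation a x g)).
move=> x y ax xy yb.
have ay : a <= y := le_trans ax xy.
have xb : x <= b := le_trans xy yb.
have fx : total_variation a x g \is a fin_num.
  by apply/bounded_variationP => //; exact: bounded_variationl bvg.
have fxy : total_variation x y g \is a fin_num.
  apply/bounded_variationP => //; apply: (bounded_variationr ax) => //.
  exact: bounded_variationl bvg.
rewrite (total_variationD g ax xy) fineD// addrAC subrr add0r.
by rewrite -lee_fin fineK// total_variation_ge.
Qed.

(* Two partitions are swept simultaneously from left to right, always cutting
   the longer of the two current cells at the end of the shorter one. *)
Lemma rs_sum_merge e g V a b s1 s2 c1 c2 :
  0 <= e -> dominates a b V g -> itv_partition a b s1 -> itv_partition a b s2 ->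
  (forall i j, (i < size s1)%N -> (j < size s2)%N ->
     ppt a b s1 i < ppt a b s2 j.+1 -> ppt a b s2 j < ppt a b s1 i.+1 ->
     `|c1 i - c2 j| <= e) ->
  `|rs_sum c1 g a b s1 - rs_sum c2 g a b s2| <= e * (V b - V a).
Proof.
move=> e0; have [n] := ubnP (size s1 + size s2).
elim: n => // n IH in a s1 s2 c1 c2 *.
wlog hd : s1 s2 c1 c2 / if s1 is x :: _ then if s2 is y :: _ then x <= y else True else True.
  move=> W sn H P1 P2 C.
  case: s1 s2 sn P1 P2 C => [|x s1] [|y s2] sn P1 P2 C; try exact: W.
  have [xy|yx] := leP x y; first exact: W.
  rewrite distrC; apply: W => //; first exact: ltW.
    by rewrite addnC.
  by move=> i j si sj u v; rewrite distrC; apply: C.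
case: s1 s2 hd => [|x s1] [|y s2] hd sn H P1 P2 C.
- by rewrite /rs_sum !big_nil subrr normr0 (itv_partition_nil P1) subrr mulr0.
- by rewrite (itv_partition_nil P1) in P2; have := itv_partitionxx P2.
- by rewrite (itv_partition_nil P2) in P1; have := itv_partitionxx P1.
have ax : a < x by case: P1 => /= /andP[].
have ay : a < y by case: P2 => /= /andP[].
have Px := itv_partition_cons P1.
have Py := itv_partition_cons P2.
have xb : x <= b := itv_partition_le Px.
have hx : dominates x b V g := dominatesW (ltW ax) H.
have c0 : `|c1 0%N - c2 0%N| <= e by apply: C.
have Vx : `|g x - g a| <= V x - V a by apply: H => //; exact: ltW.
have step : `|(c1 0%N - c2 0%N) * (g x - g a)| <= e * (V x - V a).
  by rewrite normrM ler_pM.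
move: hd; rewrite le_eqVlt => /predU1P[xy|xy].
  subst y; rewrite !rs_sum_cons.
  rewrite (_ : _ - _ = (c1 0%N - c2 0%N) * (g x - g a) +
    (rs_sum (fun i => c1 i.+1) g x b s1 - rs_sum (fun i => c2 i.+1) g x b s2));
    last by ring.
  rewrite (le_trans (ler_normD _ _))//.
  rewrite (_ : e * _ = e * (V x - V a) + e * (V b - V x)); last by ring.
  rewrite lerD//; apply: IH => //.
    by move: sn; rewrite /= addSn addnS ltnS => /ltnW.
  by move=> i j si sj u v; apply: C.
(* The first cell of the second partition survives as a cell starting at [x], with the same
   coefficient [c2 0]. *)
have P2' : itv_partition x b (y :: s2).
  by case: P2 => /= /andP[_ p] l; split => //=; rewrite xy.
have /= := IH x s1 (y :: s2) (fun i => c1 i.+1) c2 _ hx Px P2'.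
move=> IHx.
rewrite (_ : rs_sum c1 _ _ _ _ - _ = (c1 0%N - c2 0%N) * (g x - g a) +
  (rs_sum (fun i => c1 i.+1) g x b s1 - rs_sum c2 g x b (y :: s2))); last first.
  by rewrite !rs_sum_cons; ring.
rewrite (le_trans (ler_normD _ _))//.
rewrite (_ : e * _ = e * (V x - V a) + e * (V b - V x)); last by ring.
rewrite lerD//; apply: IHx; first by move: sn; rewrite /= addSn ltnS.
move=> i [|j] si sj u v; apply: C => //=.
exact: lt_trans ax v.
Qed.

Lemma rs_sum_le e g V a b s c :
  0 <= e -> dominates a b V g -> itv_partition a b s ->
  (forall i, (i < size s)%N -> `|c i| <= e) ->
  `|rs_sum c g a b s| <= e * (V b - V a).
Proof.
move=> e0 H P C.
have := @rs_sum_merge e g V a b s s c (fun=> 0) e0 H P P.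
have -> : rs_sum (fun=> 0) g a b s = 0.
  by rewrite /rs_sum big1// => i _; rewrite mul0r.
by rewrite subr0; apply => i j si sj _ _ /=; rewrite subr0 C.
Qed.

(** Summation by parts trades left tags for right tags, which is harmless because [is_RS_int] allows
    arbitrary tags. It is the discrete form of the integration by parts behind the stochastic
    integral. *)
Lemma rs_sum_abel f g a b s : itv_partition a b s ->
  rs_sum (fun i => g (ppt a b s i)) f a b s =
  g b * f b - g a * f a - rs_sum (fun i => f (ppt a b s i.+1)) g a b s.
Proof.
elim: s a => [a /itv_partition_nil ->|x s IH a P].
  by rewrite /rs_sum !big_nil !subrr.
rewrite !rs_sum_cons; have := IH _ (itv_partition_cons P); rewrite /ppt/= => ->.
by ring.
Qed.

Lemma fine_partition_nil a b delta : fine_partition a b delta [::] -> a = b.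
Proof. by move=> [/itv_partition_nil]. Qed.

Lemma fine_partitionxx a delta : fine_partition a a delta [::].
Proof. by split; [split; rewrite /= ?eqxx|move=> i]. Qed.

Lemma fine_partition_cons a b delta x s :
  fine_partition a b delta (x :: s) <->
  [/\ a < x, x - a < delta & fine_partition x b delta s].
Proof.
split=> [[P F]|[ax xd [[P L] F]]].
  split; first by case: P => /= /andP[].
    exact: (F 0%N).
  split; first exact: itv_partition_cons P.
  by move=> i si; have := F i.+1 si.
split; first by split => //=; rewrite ax.
by move=> [|i] si //; exact: F.
Qed.

Lemma fine_partition_cat a b t delta s1 s2 :
  fine_partition a t delta s1 -> fine_partition t b delta s2 ->
  fine_partition a b delta (s1 ++ s2).
Proof.
elim: s1 a => [a /fine_partition_nil ->//|x s1 IH a].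
move=> /fine_partition_cons[ax xd F1] F2; apply/fine_partition_cons; split => //.
exact: IH.
Qed.

Lemma fine_partition_le a b d1 d2 s : d1 <= d2 ->
  fine_partition a b d1 s -> fine_partition a b d2 s.
Proof. by move=> d12 [P F]; split=> // i /F /lt_le_trans; exact. Qed.

Lemma fine_partition_exists a b delta : a <= b -> 0 < delta ->
  exists s, fine_partition a b delta s.
Proof.
(* Steps of length delta / 2 keep the mesh strictly below [delta]; the induction is on their
   number. *)
move=> ab d0; have [n] : exists n : nat, b - a <= n%:R * (delta / 2).
  exists (Num.bound ((b - a) / (delta / 2))).
  rewrite -ler_pdivrMr; last lra.
  by rewrite ltW// archi_boundP// divr_ge0//; lra.
elim: n a ab => [|n IH] a ab H.
  have -> : b = a by apply/le_anti; rewrite ab/=; move: H; rewrite mul0r; lra.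
  by exists [::]; exact: fine_partitionxx.
have [ab'|ab'] := ltP (b - a) delta.
  have [->|anb] := eqVneq a b; first by exists [::]; exact: fine_partitionxx.
  have altb : a < b by rewrite lt_neqAle anb.
  exists [:: b]; apply/fine_partition_cons; split => //; exact: fine_partitionxx.
have [|| s sP] := IH (a + delta / 2); first lra.
  by move: H; rewrite -natr1; lra.
by exists (a + delta / 2 :: s); apply/fine_partition_cons; split => //; lra.
Qed.

Lemma ppt_itv a b s i : (i < size s)%N -> itv_partition a b s ->
  [/\ a <= ppt a b s i, ppt a b s i < ppt a b s i.+1 & ppt a b s i.+1 <= b].
Proof.
move=> si P; split.
- by apply: itv_partition_nth_ge => //; exact: ltnW.
- by case: P => /(pathP b)/(_ i si).
- exact: itv_partition_nth_le.
Qed.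

End RS_sums.

(** * The Riemann-Stieltjes integral of a continuous function *)

Section RS_integral.
Context {R : realType}.
Implicit Types (f g V : R -> R) (a b t delta : R) (s : seq R) (z : nat -> R).

Definition tagged a b s z := forall i, (i < size s)%N ->
  ppt a b s i <= z i <= ppt a b s i.+1.

Lemma left_tagged a b s : itv_partition a b s -> tagged a b s (ppt a b s).
Proof. by move=> P i si; have [_ /ltW -> _] := ppt_itv si P; rewrite lexx. Qed.

Lemma right_tagged a b s : itv_partition a b s ->
  tagged a b s (fun i => ppt a b s i.+1).
Proof. by move=> P i si; have [_ /ltW -> _] := ppt_itv si P; rewrite lexx. Qed.

Lemma tagged_itv a b s z i : itv_partition a b s -> tagged a b s z ->
  (i < size s)%N -> a <= z i <= b.
Proof.
move=> P Z si; have [ap _ pb] := ppt_itv si P; have /andP[pz zp] := Z i si.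
by rewrite (le_trans ap pz) (le_trans zp pb).
Qed.

Lemma rs_sum_cauchy a b V f g e : a <= b -> dominates a b V g ->
  {within `[a, b], continuous f} -> 0 < e ->
  exists2 delta, 0 < delta & forall s1 z1 s2 z2,
    fine_partition a b delta s1 -> tagged a b s1 z1 ->
    fine_partition a b delta s2 -> tagged a b s2 z2 ->
    `|rs_sum (f \o z1) g a b s1 - rs_sum (f \o z2) g a b s2| <= e.
Proof.
move=> ab H fc e0; have Vab : V a <= V b := dominates_le H (lexx a) ab (lexx b).
(* The added 1 keeps the denominator positive when [V b = V a]. *)
pose e' := e / (V b - V a + 1).
have e'0 : 0 < e' by rewrite divr_gt0//; lra.
have [d d0 dP] := segment_unif_continuous fc e'0.
(* Tags of two overlapping cells are less than twice the mesh apart. *)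
exists (d / 2); first lra.
move=> s1 z1 s2 z2 [P1 F1] Z1 [P2 F2] Z2.
have e'e : e' * (V b - V a) <= e.
  by rewrite /e' mulrAC ler_pdivrMr ?ler_wpM2l//; lra.
apply: le_trans e'e; apply: rs_sum_merge => //; first exact: ltW.
move=> i j si sj u v; apply/ltW/dP.
- exact: tagged_itv P1 Z1 si.
- exact: tagged_itv P2 Z2 sj.
have := F1 i si; have := F2 j sj.
have /andP[] := Z1 i si; have /andP[] := Z2 j sj.
by rewrite ltr_norml; lra.
Qed.

(** Completeness enters through a supremum: [E] collects the numbers lying below all sums of
    sufficiently small mesh, so [sup E] is a lower limit, and [rs_sum_cauchy] makes it the limit. *)
Lemma is_RS_int_exists a b f g : a <= b -> bounded_variation a b g ->
  {within `[a, b], continuous f} -> exists I, is_RS_int f g a b I.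
Proof.
move=> ab bvg fc; have [V H] := bounded_variation_dominated ab bvg.
pose E : set R := [set y | exists2 delta : R, 0 < delta & forall s z,
  fine_partition a b delta s -> tagged a b s z ->
  y <= rs_sum (f \o z) g a b s].
have bnd e : 0 < e -> exists2 delta : R, 0 < delta & forall s z,
    fine_partition a b delta s -> tagged a b s z ->
    E (rs_sum (f \o z) g a b s - e) /\ ubound E (rs_sum (f \o z) g a b s + e).
  move=> e0; have [d d0 dP] := rs_sum_cauchy ab H fc e0.
  exists d => // s z F Z; split.
    exists d => // s' z' F' Z'; have := dP _ _ _ _ F Z F' Z'.
    by rewrite ler_norml; lra.
  move=> y [d' d'0 /= yP].
  have dd : 0 < Num.min d d' by rewrite lt_min d0.
  have [s' F'] := fine_partition_exists ab dd.
  have Z' := left_tagged (proj1 F').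
  have F1 : fine_partition a b d s' by apply: fine_partition_le F'; rewrite ge_min lexx.
  have F2 : fine_partition a b d' s' by apply: fine_partition_le F'; rewrite ge_min lexx orbT.
  by have := yP _ _ F2 Z'; have := dP _ _ _ _ F Z F1 Z'; rewrite ler_norml; lra.
exists (sup E) => e e0; have [d d0 dP] := bnd (e / 2) ltac:(lra).
exists d => // s z F Z; have [lo hi] := dP s z F Z.
change (`|rs_sum (f \o z) g a b s - sup E| < e).
have hub : has_ubound E by exists (rs_sum (f \o z) g a b s + e / 2).
have h1 : rs_sum (f \o z) g a b s - e / 2 <= sup E by apply: ub_le_sup.
have h2 : sup E <= rs_sum (f \o z) g a b s + e / 2.
  by apply: ge_sup => //; eexists; exact: lo.
by rewrite ltr_norml; lra.
Qed.

Lemma is_RS_int_unique a b f g I J : a <= b ->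
  is_RS_int f g a b I -> is_RS_int f g a b J -> I = J.
Proof.
move=> ab HI HJ; apply/eqP; rewrite -subr_eq0; apply/eqP/normr0_eq0.
apply/le_anti; rewrite normr_ge0 andbT; apply/ler_addgt0Pl => e e0; rewrite addr0.
have [d1 d10 P1] := HI (e / 2) ltac:(lra).
have [d2 d20 P2] := HJ (e / 2) ltac:(lra).
have dd : 0 < Num.min d1 d2 by rewrite lt_min d10.
have [s F] := fine_partition_exists ab dd.
have Z := left_tagged (proj1 F).
have /P1/(_ Z) : fine_partition a b d1 s by apply: fine_partition_le F; rewrite ge_min lexx.
have /P2/(_ Z) : fine_partition a b d2 s by apply: fine_partition_le F; rewrite ge_min lexx orbT.
by rewrite ler_norml !ltr_norml; lra.
Qed.

Lemma is_RS_intE a b f g I : a <= b -> is_RS_int f g a b I -> RS_int f g a b = I.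
Proof.
move=> ab H; apply: is_RS_int_unique (ab) _ (H).
exact: xgetI H.
Qed.

Lemma is_RS_int_lim a b f g I : is_RS_int f g a b I ->
  forall e, 0 < e -> exists2 delta : R, 0 < delta & forall s z,
    fine_partition a b delta s -> tagged a b s z ->
    `|rs_sum (f \o z) g a b s - I| < e.
Proof. exact. Qed.

Lemma is_RS_int_le a b f g V M I : a <= b -> 0 <= M -> dominates a b V g ->
  (forall u, a <= u <= b -> `|f u| <= M) -> is_RS_int f g a b I ->
  `|I| <= M * (V b - V a).
Proof.
move=> ab M0 H fM HI; apply/ler_addgt0Pl => e e0.
have [d d0 P] := is_RS_int_lim HI e0.
have [s F] := fine_partition_exists ab d0.
have Z := left_tagged (proj1 F).
have h1 := P _ _ F Z.
have h2 : `|rs_sum (f \o ppt a b s) g a b s| <= M * (V b - V a).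
  apply: rs_sum_le => //; first exact: (proj1 F).
  by move=> i si; apply: fM; exact: tagged_itv (proj1 F) Z si.
have -> : I = rs_sum (f \o ppt a b s) g a b s
  - (rs_sum (f \o ppt a b s) g a b s - I) by ring.
by rewrite (le_trans (ler_normB _ _))// addrC lerD// ltW.
Qed.

Lemma is_RS_intD a b f1 f2 g I1 I2 :
  is_RS_int f1 g a b I1 -> is_RS_int f2 g a b I2 ->
  is_RS_int (fun u => f1 u + f2 u) g a b (I1 + I2).
Proof.
move=> H1 H2 e e0.
have [d1 d10 P1] := H1 (e / 2) ltac:(lra).
have [d2 d20 P2] := H2 (e / 2) ltac:(lra).
exists (Num.min d1 d2); first by rewrite lt_min d10.
move=> s z F Z.
have /P1/(_ Z) : fine_partition a b d1 s by apply: fine_partition_le F; rewrite ge_min lexx.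
have /P2/(_ Z) : fine_partition a b d2 s by apply: fine_partition_le F; rewrite ge_min lexx orbT.
under [in X in _ -> _ -> X]eq_bigr do rewrite mulrDl.
by rewrite big_split/= !ltr_norml; lra.
Qed.

Lemma is_RS_intZ a b f g k I : is_RS_int f g a b I ->
  is_RS_int (fun u => k * f u) g a b (k * I).
Proof.
move=> H e e0; have k0 : 0 < `|k| + 1 by have := normr_ge0 k; lra.
have [d d0 P] := H (e / (`|k| + 1)) (divr_gt0 e0 k0).
exists d => // s z F Z; have := P s z F Z.
under [in X in _ -> X]eq_bigr do rewrite -mulrA.
rewrite -mulr_sumr -mulrBr normrM ltr_pdivlMr// => /le_lt_trans; apply.
by rewrite mulrC ler_wpM2l// lerDl.
Qed.

Lemma eq_is_RS_int a b f1 f2 g I : (forall u, a <= u <= b -> f1 u = f2 u) ->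
  is_RS_int f1 g a b I -> is_RS_int f2 g a b I.
Proof.
move=> E H e e0; have [d d0 P] := H e e0; exists d => // s z F Z.
have := P s z F Z; congr (`| _ - _ | < _); apply: eq_big_nat => i /andP[_ si].
by rewrite E//; exact: tagged_itv (proj1 F) Z si.
Qed.

Lemma rs_sum_cat0 c g a t b s1 s2 :
  itv_partition a t s1 -> itv_partition t b s2 ->
  (forall u, t <= u <= b -> g u = 0) ->
  rs_sum c g a b (s1 ++ s2) = rs_sum c g a t s1.
Proof.
move=> + P2 g0; elim: s1 a c => [a c /itv_partition_nil ->|x s1 IH a c P1].
  rewrite /rs_sum /= big_nil big_nat big1// => i /andP[_ si].
  have [ti iS Sb] := ppt_itv si P2.
  by rewrite !g0 ?subrr ?mulr0// ?ti ?Sb ?(le_trans ti (ltW iS)) ?(le_trans (ltW iS) Sb).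
by rewrite cat_cons !rs_sum_cons IH//; exact: itv_partition_cons P1.
Qed.

Lemma tagged_cat a t b s1 s2 z :
  itv_partition a t s1 -> itv_partition t b s2 -> tagged a t s1 z ->
  exists2 z', tagged a b (s1 ++ s2) z' & forall i, (i < size s1)%N -> z' i = z i.
Proof.
move=> + P2; elim: s1 a z => [a z /itv_partition_nil -> _|x s1 IH a z P1 Z].
  by exists (ppt t b s2) => //; exact: left_tagged.
have [z' Z' zE] := IH x (fun i => z i.+1) (itv_partition_cons P1) (fun i => Z i.+1).
exists (fun i => if i is j.+1 then z' j else z 0%N); last by case=> // i /zE.
by case=> [|i] si; [exact: (Z 0%N)|exact: Z'].
Qed.

Lemma eq_rs_sum c1 c2 g a b s : (forall i, (i < size s)%N -> c1 i = c2 i) ->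
  rs_sum c1 g a b s = rs_sum c2 g a b s.
Proof. by move=> E; apply: eq_big_nat => i /andP[_ /E ->]. Qed.

(* A partition of [a, t] is completed by a fine partition of [t, b], whose cells
   do not contribute. *)
Lemma is_RS_intW a t b f g I : t <= b ->
  (forall u, t <= u <= b -> g u = 0) ->
  is_RS_int f g a b I -> is_RS_int f g a t I.
Proof.
move=> tb g0 H e e0; have [d d0 P] := is_RS_int_lim H e0; exists d => // s z F Z.
have [s' F'] := fine_partition_exists tb d0.
have [z' Z' zE] := tagged_cat (proj1 F) (proj1 F') Z.
have := P _ _ (fine_partition_cat F F') Z'.
rewrite (rs_sum_cat0 _ (proj1 F) (proj1 F') g0).
by rewrite (@eq_rs_sum _ (f \o z))// => i /zE /= ->.
Qed.

(** This makes the functional built from a kernel non-anticipative. *)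
Lemma is_RS_int_local a t b f1 f2 g I1 I2 : a <= t -> t <= b ->
  (forall u, t <= u <= b -> g u = 0) ->
  (forall u, a <= u <= t -> f1 u = f2 u) ->
  is_RS_int f1 g a b I1 -> is_RS_int f2 g a b I2 -> I1 = I2.
Proof.
move=> at_ tb g0 E /(is_RS_intW tb g0) H1 /(is_RS_intW tb g0) H2.
exact: is_RS_int_unique at_ (eq_is_RS_int E H1) H2.
Qed.

End RS_integral.

(** * Riesz representation on the paths vanishing at 0 *)

Section ramps.
Context {R : realType}.
Implicit Types (s k u y a : R).

Definition clamp01 y : R := if y <= 0 then 0 else if 1 <= y then 1 else y.

(** For k > 0 a continuous stand-in for the indicator of ]s, +oo[, rising from 0 at [s] to 1 at s +
    1/k. Starting at [s] and not before puts it in [C00] even for s = 0, and leads to a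
    right-continuous kernel. *)
Definition ramp s k u : R := clamp01 (k * (u - s)).

(** Soft thresholding: for a >= 0, [y] minus its projection on [-a, a]. It shrinks supports of
    continuous functions in the Riesz argument and measures the excess over a level in the uniform
    integrability argument. *)
Definition soft a y : R := if a < y then y - a else if y < - a then y + a else 0.

Lemma clamp01_itv y : 0 <= clamp01 y <= 1.
Proof. by rewrite /clamp01; case: (leP y 0) => ?; case: (leP 1 y) => ?; lra. Qed.

Lemma clamp01_0 y : y <= 0 -> clamp01 y = 0.
Proof. by rewrite /clamp01; case: (leP y 0) => ?; case: (leP 1 y) => ?; lra. Qed.

Lemma clamp01_1 y : 1 <= y -> clamp01 y = 1.
Proof. by rewrite /clamp01; case: (leP y 0) => ?; case: (leP 1 y) => ?; lra. Qed.

Lemma clamp01_le y z : y <= z -> clamp01 y <= clamp01 z.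
Proof.
by rewrite /clamp01; case: (leP 1 y) => ?; case: (leP 1 z) => ?;
  case: (leP y 0) => ?; case: (leP z 0) => ?; lra.
Qed.

Lemma clamp01_lip y z : `|clamp01 y - clamp01 z| <= `|y - z|.
Proof.
wlog yz : y z / y <= z.
  by move=> W; have [/W//|/ltW/W] := leP y z; rewrite distrC (distrC y).
rewrite distrC (distrC y) !ger0_norm ?subr_ge0 ?clamp01_le//.
by rewrite /clamp01; case: (leP 1 y) => ?; case: (leP 1 z) => ?;
  case: (leP y 0) => ?; case: (leP z 0) => ?; lra.
Qed.

Lemma ramp_itv s k u : 0 <= ramp s k u <= 1.
Proof. exact: clamp01_itv. Qed.

Lemma ramp0 s k u : 0 <= k -> u <= s -> ramp s k u = 0.
Proof. by move=> k0 us; apply: clamp01_0; rewrite mulr_ge0_le0// subr_le0. Qed.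

Lemma ramp1 s k u d : 0 < d -> d^-1 <= k -> s + d <= u -> ramp s k u = 1.
Proof.
move=> d0 dk su; apply: clamp01_1; rewrite -(mulVf (lt0r_neq0 d0)).
by rewrite ler_pM ?invr_ge0 ?(ltW d0)//; lra.
Qed.

Lemma ramp_le s1 s2 k u : 0 <= k -> s1 <= s2 -> ramp s2 k u <= ramp s1 k u.
Proof. by move=> k0 s12; apply: clamp01_le; rewrite ler_wpM2l//; lra. Qed.

Lemma ramp_nd s k u v : 0 <= k -> u <= v -> ramp s k u <= ramp s k v.
Proof. by move=> k0 uv; apply: clamp01_le; rewrite ler_wpM2l//; lra. Qed.

Lemma soft_dist a y : 0 <= a -> `|y - soft a y| <= a.
Proof. by rewrite /soft => a0; case: (ltP a y) => ?; [|case: (ltP y (- a)) => ?]; rewrite ler_norml; lra. Qed.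

Lemma soft_norm a y : 0 <= a -> `|soft a y| <= `|y|.
Proof.
by rewrite /soft => a0; case: (ltP a y) => ?; [|case: (ltP y (- a)) => ?];
  rewrite ler_norml; have := ler_norm y; have := ler_norm (- y); rewrite normrN; lra.
Qed.

Lemma soft_eq0 a y : `|y| <= a -> soft a y = 0.
Proof. by rewrite /soft ler_norml => ya; case: (ltP a y) => ?; [|case: (ltP y (- a)) => ?]; lra. Qed.

Lemma soft_lip a y z : 0 <= a -> `|soft a y - soft a z| <= `|y - z|.
Proof.
move=> a0; wlog yz : y z / y <= z.
  by move=> W; have [/W//|/ltW/W] := leP y z; rewrite distrC (distrC y).
rewrite (ler0_norm (x := y - z)) ?subr_le0// ler_norml /soft.
by case: (ltP a y) => ?; [|case: (ltP y (- a)) => ?];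
  (case: (ltP a z) => ?; [|case: (ltP z (- a)) => ?]); lra.
Qed.

End ramps.

Section paths.
Context {R : realType}.
Variable T : R.
Implicit Types (x y : R -> R) (k : R).

Lemma C0T_cst k : C0T T (fun=> k).
Proof. by move=> ?; apply: continuous_subspaceT => ?; exact: cvg_cst. Qed.

Lemma C0TD x y : C0T T x -> C0T T y -> C0T T (fun u => x u + y u).
Proof. by move=> cx cy; exact: within_continuousD. Qed.

Lemma C0T_lip (phi : R -> R) x : (forall v w, `|phi v - phi w| <= `|v - w|) ->
  C0T T x -> C0T T (fun u => phi (x u)).
Proof.
move=> H /within_continuousP cx; apply/within_continuousP => u uT e e0.
have [d d0 dP] := cx u uT e e0; exists d => // v vT uv.
exact: le_lt_trans (H _ _) (dP _ vT uv).
Qed.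

Lemma C0TZ k x : C0T T x -> C0T T (fun u => k * x u).
Proof.
move=> /within_continuousP cx; apply/within_continuousP => u uT e e0.
have k0 : 0 < `|k| + 1 by have := normr_ge0 k; lra.
have [d d0 dP] := cx u uT (e / (`|k| + 1)) (divr_gt0 e0 k0).
exists d => // v vT uv; have := dP v vT uv.
rewrite -mulrBr normrM ltr_pdivlMr// => /le_lt_trans; apply.
by rewrite mulrC ler_wpM2l// lerDl.
Qed.

Lemma C0T_sum n (c : nat -> R) (f : nat -> R -> R) : (forall i, C0T T (f i)) ->
  C0T T (fun u => \sum_(0 <= i < n) c i * f i u).
Proof.
move=> cf; elim: n => [|n IH].
  by under eq_fun do rewrite big_nil; exact: C0T_cst.
have := C0TD IH (C0TZ (k := c n) (cf n)); congr (C0T _ _).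
by apply/funext => u; rewrite big_nat_recr.
Qed.

Lemma C0T_ramp s k : C0T T (ramp s k).
Proof.
apply: (@C0T_lip clamp01 (fun u => k * (u - s))); first exact: clamp01_lip.
apply: C0TZ; apply: (C0TD (x := id)); last exact: C0T_cst.
by move=> ?; apply: continuous_subspaceT => ?; exact: cvg_id.
Qed.

(** Semimartingales vanish at 0, so these are the only paths on which linearity can be deduced from
    the functional equation. *)
Definition C00 : set (R -> R) := [set x | C0T T x /\ x 0 = 0].

Lemma C00D x y : C00 x -> C00 y -> C00 (fun u => x u + y u).
Proof. by move=> [cx x0] [cy y0]; split; [exact: C0TD|rewrite x0 y0 addr0]. Qed.

Lemma C00Z k x : C00 x -> C00 (fun u => k * x u).
Proof. by move=> [cx x0]; split; [exact: C0TZ|rewrite x0 mulr0]. Qed.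

Lemma C00B x y : C00 x -> C00 y -> C00 (fun u => x u - y u).
Proof.
move=> cx /(C00Z (-1)) cy; have := C00D cx cy; congr (C00 _).
by apply/funext => u; rewrite mulN1r.
Qed.

Lemma C00_sum n (c : nat -> R) (f : nat -> R -> R) : (forall i, C00 (f i)) ->
  C00 (fun u => \sum_(0 <= i < n) c i * f i u).
Proof.
move=> cf; split; first by apply: C0T_sum => i; exact: (proj1 (cf i)).
by rewrite big1// => i _; rewrite (proj2 (cf i)) mulr0.
Qed.

Lemma C00_ramp s k : 0 <= k -> 0 <= s -> C00 (ramp s k).
Proof. by move=> k0 s0; split; [exact: C0T_ramp|exact: ramp0]. Qed.

Lemma C00_0 : C00 (fun=> 0).
Proof. by split=> //; exact: C0T_cst. Qed.

(* The increments of the ramps form a partition of unity subordinate to the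
   cells, up to their overlap of length [d] and to the vicinity of 0. *)
Lemma ramp_approx x e : C00 x -> 0 < e -> exists2 d : R, 0 < d &
  forall s z k, fine_partition 0 T d s -> tagged 0 T s z -> d^-1 <= k ->
  forall u, 0 <= u <= T ->
  `|x u - \sum_(0 <= i < size s) x (z i) *
            (ramp (ppt 0 T s i) k u - ramp (ppt 0 T s i.+1) k u)| <= e.
Proof.
move=> [cx x0] e0; have [d d0 dP] := segment_unif_continuous cx e0.
(* Half of [d] for the mesh and half for the overlap of neighbouring weights. *)
exists (d / 2); first lra.
move=> s z k F Z dk u uT.
have d20 : 0 < d / 2 by lra.
have k0 : 0 <= k by apply: le_trans dk; rewrite invr_ge0 ltW.
pose w i := ramp (ppt 0 T s i) k u - ramp (ppt 0 T s i.+1) k u.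
have w0 i : (i < size s)%N -> 0 <= w i.
  by move=> si; have [_ /ltW ? _] := ppt_itv si (proj1 F); rewrite subr_ge0 ramp_le.
have T0 : 0 <= T by lra.
have sw : \sum_(0 <= i < size s) w i = ramp 0 k u.
  rewrite (eq_big_nat _ _ (F2 := fun i => - ramp (ppt 0 T s i.+1) k u -
    - ramp (ppt 0 T s i) k u)); last by move=> i _; rewrite /w; ring.
  rewrite (telescope_sumr (fun i => - ramp (ppt 0 T s i) k u))//.
  (* The ramp starting at T vanishes on [0, T], so the weights add up to [ramp 0 k u], which is 1
     from half the modulus [d] onwards. *)
  rewrite {1}/ppt (itv_partition_nth_size T (proj1 F)) [ramp T k u]ramp0//; last lra.
  by rewrite /ppt /=; ring.
have /andP[r0 r1] := ramp_itv 0 k u.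
(* The weight missing near the origin multiplies [x u], which is small there because [x 0 = 0]. *)
rewrite (_ : _ - _ = x u * (1 - ramp 0 k u) +
    \sum_(0 <= i < size s) (x u - x (z i)) * w i); last first.
  rewrite -sw mulrBr mulr1 mulr_sumr -addrA; congr (_ + _).
  rewrite -sumrN -[X in _ = X + _]sumrN -big_split/=; apply: eq_bigr => i _.
  by rewrite /w; ring.
rewrite (le_trans (ler_normD _ _))//.
have -> : e = e * (1 - ramp 0 k u) + e * ramp 0 k u by ring.
apply: lerD.
  rewrite normrM (ger0_norm (x := 1 - _)); last lra.
  have [ud|du] := leP (d / 2) u.
    by rewrite (ramp1 d20 dk) ?add0r// subrr !mulr0.
  rewrite ler_wpM2r//; first lra.
  rewrite -[x u]subr0 -x0; apply/ltW/dP => //; first by rewrite lexx.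
  by rewrite ltr_norml; lra.
rewrite -sw mulr_sumr (le_trans (ler_norm_sum _ _ _))//.
rewrite big_nat [leRHS]big_nat; apply: ler_sum => i /andP[_ si].
rewrite normrM (ger0_norm (w0 i si)).
have zT := tagged_itv (proj1 F) Z si.
have Zi := Z i si.
have Fi := proj2 F i si.
have [h1|h1] := leP u (ppt 0 T s i).
  suff -> : w i = 0 by rewrite !mulr0.
  by rewrite /w !ramp0 ?subrr//; lra.
have [h2|h2] := leP (ppt 0 T s i.+1 + d / 2) u.
  suff -> : w i = 0 by rewrite !mulr0.
  by rewrite /w !(ramp1 d20 dk) ?subrr//; lra.
rewrite ler_wpM2r ?w0//; apply/ltW/dP => //.
by rewrite ltr_norml; lra.
Qed.

End paths.

Lemma cvgr_norm_le {R : realType} (u : nat -> R) (l e : R) :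
  u @ \oo --> l -> (\forall n \near \oo, `|u n| <= e) -> `|l| <= e.
Proof. by move=> /cvg_norm ul ue; exact: cvgr_to_le ul ue. Qed.

(** * The kernel of a bounded linear form on [C00] *)

Section Riesz.
Context {R : realType}.
Variables (T : R) (L : (R -> R) -> R) (B : R).
Hypothesis L_add : forall x y, C00 T x -> C00 T y ->
  L (fun u => x u + y u) = L x + L y.
Hypothesis L_scale : forall k x, C00 T x -> L (fun u => k * x u) = k * L x.
Hypothesis L_bnd : forall x M, C00 T x ->
  (forall u, 0 <= u <= T -> `|x u| <= M) -> `|L x| <= B * M.
Implicit Types (x psi : R -> R) (s u v : R).

Let B_ge0 : 0 <= B.
Proof.
have := L_bnd (M := 1) (C00_0 T); rewrite normr0 mulr1 => H.
by apply: le_trans (H _) => // u _; exact: ler01.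
Qed.

Lemma functionalB x y : C00 T x -> C00 T y -> L (fun u => x u - y u) = L x - L y.
Proof.
move=> cx cy; rewrite -[- L y]mulN1r -L_scale// -L_add//; last exact: C00Z.
by congr L; apply/funext => u; rewrite mulN1r.
Qed.

Lemma functional0 : L (fun=> 0) = 0.
Proof.
rewrite -[RHS](subrr (L (fun=> 0))) -functionalB; try exact: C00_0.
by congr L; apply/funext => u; rewrite subrr.
Qed.

Lemma functional_sum n (c : nat -> R) (f : nat -> R -> R) :
  (forall i, C00 T (f i)) ->
  L (fun u => \sum_(0 <= i < n) c i * f i u) = \sum_(0 <= i < n) c i * L (f i).
Proof.
move=> cf; elim: n => [|n IH].
  by rewrite big_nil -[RHS]functional0; congr L; apply/funext => u; rewrite big_nil.
rewrite big_nat_recr//= -IH -L_scale// -L_add; last 2 first.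
- exact: C00_sum.
- exact: C00Z.
by congr L; apply/funext => u; rewrite big_nat_recr.
Qed.

(* Otherwise one could stack arbitrarily many functions of norm at most 1 with
   disjoint supports accumulating at [s], on which [L] is bounded below. *)
Lemma functional_tight s e : 0 <= s -> 0 < e -> exists2 d : R, 0 < d &
  forall psi, C00 T psi -> (forall u, 0 <= u <= T -> `|psi u| <= 1) ->
  (forall u, 0 <= u <= T -> (u <= s) || (s + d <= u) -> psi u = 0) ->
  `|L psi| <= e.
Proof.
move=> s0 e0; have B0 := B_ge0; apply: contrapT => N.
have {}N (d : R) : 0 < d -> exists psi, [/\ C00 T psi,
    forall u, 0 <= u <= T -> `|psi u| <= 1,
    forall u, 0 <= u <= T -> (u <= s) || (s + d <= u) -> psi u = 0 &
    e < `|L psi|].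
  move=> d0; apply: contrapT => N'; apply: N; exists d => // psi h1 h2 h3.
  by rewrite leNgt; apply/negP => h4; apply: N'; exists psi.
have key (k : nat) : exists x, [/\ C00 T x, forall u, 0 <= u <= T -> `|x u| <= 1,
    k%:R * (e / 2) <= L x & exists2 h : R, 0 < h &
    forall u, 0 <= u <= T -> u <= s + h -> x u = 0].
  elim: k => [|k [x [cx x1 Lx [h h0 xh]]]].
    exists (fun=> 0); split; [exact: C00_0|..]; last by exists 1.
      by move=> u _; rewrite normr0.
    by rewrite mul0r functional0.
  have [psi [cpsi psi1 psi0 Lpsi]] := N h h0.
  (* Thresholding at [a] changes [L psi] by at most B a <= e / 2, so at least e / 2 of it
     remains. *)
  pose a := e / (2 * (B + 1)).
  have a0 : 0 < a by rewrite divr_gt0// mulr_gt0//; lra.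
  have aB : B * a <= e / 2.
    have -> : e / 2 = (B + 1) * a by rewrite /a; field; lra.
    by rewrite ler_wpM2r//; lra.
  pose psi' u := soft a (psi u).
  have cpsi' : C00 T psi'.
    split; last by rewrite /psi' (proj2 cpsi) soft_eq0// normr0 ltW.
    by apply: C0T_lip (proj1 cpsi) => v w; exact/soft_lip/ltW.
  have dL : `|L psi - L psi'| <= e / 2.
    rewrite -functionalB//; apply: le_trans aB; apply: L_bnd; first exact: C00B.
    by move=> u _; apply/soft_dist/ltW.
  have Lpsi' : e / 2 <= `|L psi'|.
    have := ler_normD (L psi - L psi') (L psi'); rewrite subrK; lra.
  (* Just to the right of [s], [psi] stays below [a] by continuity, so [psi'] vanishes there; this
     frees an interval at [s] for the next function of the stack. *)
  have [d d0 dP] := segment_unif_continuous (proj1 cpsi) a0.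
  pose h' := Num.min h (d / 2).
  have h'0 : 0 < h' by rewrite lt_min h0/=; lra.
  have h'h : h' <= h by rewrite ge_min lexx.
  have h'd : h' <= d / 2 by rewrite ge_min lexx orbT.
  have psi'0 u : 0 <= u <= T -> u <= s + h' -> psi' u = 0.
    move=> uT us; apply: soft_eq0; have [us'|su] := leP u s.
      by rewrite psi0 ?us'// normr0 ltW.
    have sT : 0 <= s <= T by lra.
    have -> : psi u = psi u - psi s by rewrite (psi0 s) ?subr0// lexx.
    by apply/ltW/dP => //; rewrite ltr_norml; lra.
  have psi'x u : 0 <= u <= T -> s + h < u -> psi' u = 0.
    by move=> uT us; apply: soft_eq0; rewrite psi0 ?normr0 ?(ltW a0)// (ltW us) orbT.
  (* [x] vanishes up to s + h and [psi'] beyond it, so the norm stays at most 1; the sign makes the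
     two values of [L] add up. *)
  exists (fun u => x u + Num.sg (L psi') * psi' u); split.
  - by apply: C00D => //; exact: C00Z.
  - move=> u uT; have [us|su] := leP u (s + h).
      rewrite xh// add0r normrM; apply: le_trans (psi1 u uT).
      rewrite normr_sg; apply: le_trans (soft_norm (psi u) (ltW a0)).
      by rewrite -[leRHS]mul1r ler_wpM2r// lern1; case: eqP.
    by rewrite psi'x// mulr0 addr0 x1.
  - rewrite L_add ?L_scale//; last exact: C00Z.
    by rewrite -normrEsg -natr1 mulrDl mul1r lerD.
  - exists h' => // u uT us; rewrite psi'0// mulr0 addr0 xh//; lra.
have [x [cx x1 Lx _]] := key (Num.bound (B / (e / 2))).
have := L_bnd cx x1; rewrite mulr1 => LB.
have : B / (e / 2) < (Num.bound (B / (e / 2)))%:R.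
  by rewrite archi_boundP// divr_ge0//; lra.
rewrite ltr_pdivrMr; last lra.
by have := ler_norm (L x); lra.
Qed.

Let rmp s (n : nat) := ramp s (n.+1%:R : R).

Let crmp s n : 0 <= s -> C00 T (rmp s n).
Proof. by move=> s0; apply: C00_ramp. Qed.

(** The difference of two steep ramps starting shortly after [s] is bounded by 1 and supported
    shortly after [s], so [functional_tight] applies. Equal starting points give the convergence
    defining the kernel, distinct ones its right-continuity. *)
Lemma functional_ramp_near s e : 0 <= s -> 0 < e -> exists2 d : R, 0 < d &
  forall s' s'' n m, s <= s' < s + d -> s <= s'' < s + d -> 
    d^-1 <= n.+1%:R -> d^-1 <= m.+1%:R ->
  `|L (rmp s' n) - L (rmp s'' m)| <= e.
Proof.
move=> s0 e0; have [d d0 dP] := functional_tight s0 e0.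
(* Half of [d] for the starting point of a ramp and half for its rise. *)
exists (d / 2); first lra.
move=> s' s'' n m s's s''s nd md.
have d20 : 0 < d / 2 by lra.
rewrite -functionalB; try (apply: crmp; lra).
apply: dP; first by apply: C00B; apply: crmp; lra.
  move=> u _; have := ramp_itv s' n.+1%:R u; have := ramp_itv s'' m.+1%:R u.
  by rewrite /rmp ler_norml; lra.
move=> u _ /orP[us|su]; first by rewrite /rmp !ramp0 ?subrr//; lra.
by rewrite /rmp (ramp1 d20 nd) ?(ramp1 d20 md) ?subrr//; lra.
Qed.

Let large (d : R) : 0 < d -> \forall n \near \oo, d^-1 <= n.+1%:R.
Proof.
move=> d0; exists (Num.bound d^-1) => // n /= dn.
rewrite (le_trans (ltW (archi_boundP _)))// ?invr_ge0 ?ltW//.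
by rewrite ltr_nat ltnS.
Qed.

Definition riesz_kernel s : R := lim (L (rmp s n) @[n --> \oo]).

Local Notation G := riesz_kernel.

Lemma riesz_kernel_cvg s : 0 <= s -> L (rmp s n) @[n --> \oo] --> G s.
Proof.
move=> s0; apply: R_complete; apply/cauchy_ballP => e e0.
have [d d0 dP] := functional_ramp_near s0 (e := e / 2) ltac:(lra).
have [N _ NP] := large d0.
exists ([set r | exists2 n, (N <= n)%N & r = L (rmp s n)],
  [set r | exists2 n, (N <= n)%N & r = L (rmp s n)]).
  by split; exists N => // n /= Nn; exists n.
move=> [_ _] /= [[n Nn ->] [m Nm ->]].
rewrite /ball /= (@le_lt_trans _ _ (e / 2))//; last lra.
by apply: dP; rewrite ?lexx ?ltrDl//; exact: NP.
Qed.

Lemma riesz_kernel_right_continuous s : 0 <= s -> G u @[u --> s^'+] --> G s.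
Proof.
move=> s0; apply/cvgrPdist_le => e e0.
have [d d0 dP] := functional_ramp_near s0 e0.
near=> u.
have su : s < u by near: u; exact: nbhs_right_gt.
have ud : u < s + d by near: u; apply: nbhs_right_lt; lra.
have u0 : 0 <= u by lra.
apply: (cvgr_norm_le (cvgB (riesz_kernel_cvg s0) (riesz_kernel_cvg u0))).
by near=> n; apply: dP; rewrite ?lexx ?ltrDl// ?(ltW su) ?ud//; near: n; exact: large.
Unshelve. all: by end_near. Qed.

Lemma riesz_kernel_variation (b : R) (s : seq R) : itv_partition 0 b s -> variation 0 b G s <= B.
Proof.
move=> P; pose p i := ppt 0 b s i.
have p0 i : (i <= size s)%N -> 0 <= p i by move=> si; exact: itv_partition_nth_ge P.
have cv : \sum_(0 <= i < size s) `|L (rmp (p i.+1) n) - L (rmp (p i) n)|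
    @[n --> \oo] --> variation 0 b G s.
  rewrite /variation big_nat; under eq_fun do rewrite big_nat.
  apply: (cvg_big (op := +%R)) => [|i /andP[_ si]]; first exact: add_continuous.
  apply: cvg_norm; apply: cvgB.
    by apply: riesz_kernel_cvg; exact: p0.
  by apply: riesz_kernel_cvg; apply: p0; exact: ltnW.
apply: (cvgr_to_le cv); apply: nearW => n.
pose w i u := rmp (p i) n u - rmp (p i.+1) n u.
(* Freezing the index at the last point makes every [f i] a member of [C00], as [functional_sum]
   asks for all indices. *)
pose q i := p (minn i (size s)).
have q0 i : 0 <= q i by apply: p0; rewrite geq_minr.
pose c i := Num.sg (L (rmp (p i.+1) n) - L (rmp (p i) n)).
pose f i u := rmp (q i.+1) n u - rmp (q i) n u.
have cf i : C00 T (f i) by apply: C00B; exact: crmp.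
have -> : \sum_(0 <= i < size s) `|L (rmp (p i.+1) n) - L (rmp (p i) n)| =
    L (fun u => \sum_(0 <= i < size s) c i * f i u).
  rewrite functional_sum//; apply: eq_big_nat => i /andP[_ si].
  rewrite /f functionalB; try exact: crmp.
  by rewrite /q (minn_idPl si) (minn_idPl (ltnW si)) normrEsg.
rewrite (le_trans (ler_norm _))// -[leRHS]mulr1; apply: L_bnd; first exact: C00_sum.
move=> u _; apply: le_trans (ler_norm_sum _ _ _) _.
have pm i : (i < size s)%N -> rmp (p i.+1) n u <= rmp (p i) n u.
  by move=> si; apply: ramp_le => //; have [_ /ltW] := ppt_itv si P.
(* The increments of the ramps all have the same sign, so their absolute values telescope and the
   coefficients [c i] cost nothing. *)
apply: (@le_trans _ _ (\sum_(0 <= i < size s)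
    (- rmp (p i.+1) n u - - rmp (p i) n u))).
  rewrite big_nat [leRHS]big_nat; apply: ler_sum => i /andP[_ si].
  rewrite normrM normr_sg /f /q (minn_idPl si) (minn_idPl (ltnW si)).
  have := pm i si => h; rewrite ler0_norm; last lra.
  rewrite -[leRHS]mul1r (_ : - (_ - _) = - rmp (p i.+1) n u - - rmp (p i) n u);
    last by ring.
  by rewrite ler_wpM2r ?lern1; [|lra|case: eqP].
rewrite (telescope_sumr (fun i => - rmp (p i) n u))//.
have := ramp_itv (p (size s)) n.+1%:R u; have := ramp_itv (p 0%N) n.+1%:R u.
by rewrite /rmp; lra.
Qed.

Lemma riesz_kernel_bounded_variation b : bounded_variation 0 b G.
Proof. by exists B => _ [s P <-]; exact: riesz_kernel_variation. Qed.

(** The increment of the kernel over a cell is minus the limit of [L] on a weight of [ramp_approx].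
    A Riemann-Stieltjes sum plus [L x] is therefore the limit of [L] on the approximation error,
    bounded by B e'. *)
Lemma riesz_representation x : C00 T x -> is_RS_int x G 0 T (- L x).
Proof.
move=> cx e e0; have B0 := B_ge0; pose e' := e / (2 * (B + 1)).
have e'0 : 0 < e' by rewrite divr_gt0// mulr_gt0//; lra.
have [d d0 dP] := ramp_approx cx e'0; exists d => // s z F Z.
pose p i := ppt 0 T s i.
have p0 i : (i <= size s)%N -> 0 <= p i by move=> si; exact: itv_partition_nth_ge (proj1 F).
pose q i := p (minn i (size s)).
have q0 i : 0 <= q i by apply: p0; rewrite geq_minr.
pose f n i u := rmp (q i) n u - rmp (q i.+1) n u.
have cf n i : C00 T (f n i) by apply: C00B; exact: crmp.
suff : `|\sum_(0 <= i < size s) x (z i) * (G (p i.+1) - G (p i)) - - L x| <= e / 2.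
  by move=> /le_lt_trans; apply; lra.
rewrite opprK.
have cv : (\sum_(0 <= i < size s) x (z i) * (L (rmp (p i.+1) n) - L (rmp (p i) n))
    + L x) @[n --> \oo] -->
    \sum_(0 <= i < size s) x (z i) * (G (p i.+1) - G (p i)) + L x.
  apply: cvgD; last exact: cvg_cst.
  rewrite big_nat; under eq_fun do rewrite big_nat.
  apply: (cvg_big (op := +%R)) => [|i /andP[_ si]]; first exact: add_continuous.
  apply: cvgMr; apply: cvgB.
    by apply: riesz_kernel_cvg; exact: p0.
  by apply: riesz_kernel_cvg; apply: p0; exact: ltnW.
apply: (cvgr_norm_le cv); near=> n.
have dn : d^-1 <= n.+1%:R by near: n; exact: large.
rewrite (_ : _ + L x = L (fun u => x u -
    \sum_(0 <= i < size s) x (z i) * f n i u)); last first.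
  rewrite functionalB//; last exact: C00_sum.
  rewrite functional_sum// addrC; congr (_ + _); rewrite -sumrN.
  apply: eq_big_nat => i /andP[_ si].
  rewrite /f functionalB; try exact: crmp.
  by rewrite /q (minn_idPl si) (minn_idPl (ltnW si)) -mulrN opprB.
apply: (@le_trans _ _ (B * e')).
  apply: L_bnd; first by apply: C00B => //; exact: C00_sum.
  move=> u uT; apply: le_trans (dP s z _ F Z dn u uT).
  rewrite le_eqVlt; apply/orP; left; apply/eqP; congr (`|_ - _|).
  apply: eq_big_nat => i /andP[_ si].
  by rewrite /f /q (minn_idPl si) (minn_idPl (ltnW si)).
have -> : e / 2 = (B + 1) * e' by rewrite /e'; field; lra.
by rewrite ler_wpM2r//; lra.
Unshelve. all: by end_near. Qed.

End Riesz.

(** * Path functionals and uniform boundedness *)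

Section left_limits.
Context {R : realType}.

(** Near [b] the increments of [g] are controlled by those of the nondecreasing bounded [V], which
    are small once [V] is close to the supremum of its values before [b]. *)
Lemma bounded_variation_left_limit (a b : R) (g : R -> R) : a < b ->
  bounded_variation a b g -> cvg (g u @[u --> b^'-]).
Proof.
move=> ab /(bounded_variation_dominated (ltW ab))[V H].
apply: R_complete; apply/cauchy_ballP => e e0.
pose E : set R := [set V u | u in [set u | a <= u < b]].
have ubE : ubound E (V b).
  by move=> _ /= [u /andP[au ub] <-]; apply: (dominates_le H) => //; exact: ltW.
have hE : has_sup E.
  by split; [exists (V a); exists a; rewrite //= lexx|exists (V b)].
have [_ [u0 /= /andP[au0 u0b] <-] u0E] := sup_adherent e0 hE.
have close u v : u0 < u -> u <= v -> v < b -> `|g u - g v| < e.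
  move=> u0u uv vb; have au : a <= u by lra.
  have h1 : `|g v - g u| <= V v - V u by apply: H => //; exact: ltW.
  have h2 : V v <= sup E.
    by apply: ub_le_sup; [exists (V b)|exists v => //=; lra].
  have h3 : V u0 <= V u by apply: (dominates_le H); lra.
  by rewrite distrC; lra.
have nb : \forall u \near b^'-, u0 < u < b.
  near=> u; apply/andP; split; last by near: u; exact: nbhs_left_lt.
  by near: u; exact: nbhs_left_gt.
pose S := [set g u | u in [set u | u0 < u < b]].
have nS : nbhs (g u @[u --> b^'-]) S by apply: filterS nb => u ub; exists u.
exists (S, S); first by split.
move=> _ /= [[u /= /andP[u0u ub] <-] [v /= /andP[u0v vb] <-]]; rewrite /ball/=.
by have [uv|/ltW vu] := leP u v; [apply: close|rewrite distrC; apply: close].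
Unshelve. all: by end_near. Qed.

End left_limits.

Section path_continuity.
Context {R : realType}.
Variable T : R.

Lemma continuous_path_functionalP (h : R -> (R -> R) -> R) :
  continuous_path_functional T h <->
  forall t x, 0 <= t <= T -> C0T T x -> forall e : R, 0 < e ->
    exists2 d : R, 0 < d & forall t' y, 0 <= t' <= T -> C0T T y ->
      `|t - t'| < d -> (forall u, 0 <= u <= T -> `|x u - y u| < d) ->
      `|h t x - h t' y| < e.
Proof.
rewrite /continuous_path_functional subspace_continuousP; split.
  move=> H t x tT cx e e0.
  have /= /cvgrPdist_lt/(_ e e0) := H (t, x) (conj tT cx).
  rewrite near_withinE => -[[U1 U2]] /= [/nbhs_ballP[d1 d10 dP1]].
  move=> /uniform_nbhs[E [+ EP]] UP.
  rewrite -entourage_ballE => -[d2 d20 dP2].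
  exists (Num.min d1 d2); first by rewrite lt_min d10.
  move=> t' y t'T cy tt' xy.
  apply: (UP (t', y)) => //; split => /=.
    by apply: dP1; rewrite /ball/=; move: tt'; rewrite lt_min => /andP[].
  apply: EP => /= u uT; apply: dP2 => /=; rewrite /ball/=.
  by have := xy u; rewrite lt_min => /(_ _)/andP[].
move=> H [t x] [/= tT cx]; apply/cvgrPdist_lt => e e0 /=.
have [d d0 dP] := H t x tT cx e e0.
rewrite near_withinE.
exists (ball t d, [set y | forall u, `[0, T]%classic u -> ball (x u) d (y u)]).
  split => /=; first exact: nbhsx_ballx.
  apply/uniform_nbhs; exists [set p | ball p.1 d p.2]; split=> //.
  exact: (entourage_ball _ (PosNum d0)).
move=> [t' y] /= [tt' xy] [t'T cy]; exact: dP.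
Qed.

End path_continuity.

(** * The principle of uniform boundedness *)

Section uniform_boundedness.
Context {R : realType} {I : Type}.
Variables (T : R) (D : set I) (L : I -> (R -> R) -> R).
Hypothesis L_add : forall t, D t -> forall x y, C0T T x -> C0T T y ->
  L t (fun u => x u + y u) = L t x + L t y.
Hypothesis L_scale : forall t, D t -> forall k x, C0T T x ->
  L t (fun u => k * x u) = k * L t x.

Let unit_ball : set (R -> R) :=
  [set x | C0T T x /\ forall u, 0 <= u <= T -> `|x u| <= 1].

Definition bounded_by (t : I) (B : R) := forall x M, C0T T x -> 0 < M ->
  (forall u, 0 <= u <= T -> `|x u| <= M) -> `|L t x| <= B * M.

Hypothesis L_bnd : forall t, D t -> exists B, bounded_by t B.
Hypothesis L_pointwise_bnd : forall x, C0T T x ->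
  exists A, forall t, D t -> `|L t x| <= A.

(** [N] is the operator norm, a supremum over the unit ball and hence nearly attained. The second
    clause asks for N > 0, since a factor below 1 leaves no strict room at 0. *)
Let norm_attained t : D t -> exists2 N, bounded_by t N &
  0 < N -> exists2 u, unit_ball u & 9 / 10 * N < `|L t u|.
Proof.
move=> Dt; have [B bB] := L_bnd Dt.
pose E : set R := [set `|L t u| | u in unit_ball].
have u0 : unit_ball (fun=> 0).
  by split; [exact: C0T_cst|move=> u _; rewrite normr0 ler01].
have hE : has_sup E.
  split; first by exists `|L t (fun=> 0)|; exists (fun=> 0).
  by exists B => _ [x [cx x1] <-]; have := bB x 1 cx ltr01 x1; rewrite mulr1.
have unitE x : unit_ball x -> `|L t x| <= sup E.
  by move=> ux; apply: ub_le_sup; [exact: (proj2 hE)|exists x].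
exists (sup E).
  move=> x M cx M0 xM.
  have : `|L t (fun u => M^-1 * x u)| <= sup E.
    apply: unitE; split; first exact: C0TZ.
    move=> u uT; rewrite normrM ger0_norm ?invr_ge0 ?(ltW M0)//.
    by rewrite ler_pdivrMl// mulr1 xM.
  rewrite L_scale// normrM ger0_norm ?invr_ge0 ?(ltW M0)//.
  by rewrite ler_pdivrMl// mulrC.
move=> N0; have N1 : 0 < sup E / 10 by lra.
have [_ [u uu <-] uE] := sup_adherent N1 hE.
by exists u => //; lra.
Qed.

(* Sokal's elementary proof of the principle of uniform boundedness. *)
Lemma uniform_boundedness : exists B, forall t, D t -> bounded_by t B.
Proof.
apply: contrapT => unb.
(* [p k] packs an index, its operator norm and a nearly extremal unit vector. Without a common
   bound, norms above k 3^k are available. *)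
have /choice[p pP] : forall k : nat, exists p : I * R * (R -> R),
    [/\ D p.1.1, bounded_by p.1.1 p.1.2, k%:R * 3 ^+ k < p.1.2,
        unit_ball p.2 & 9 / 10 * p.1.2 < `|L p.1.1 p.2|].
  move=> k; apply: contrapT => H; apply: unb; exists (k%:R * 3 ^+ k) => t Dt.
  have [N bN NP] := norm_attained Dt; have [kN|Nk] := ltP (k%:R * 3 ^+ k) N.
    have [|u uu uN] := NP; first by apply: le_lt_trans kN; rewrite mulr_ge0// exprn_ge0.
    by exfalso; apply: H; exists (t, N, u).
  move=> x M cx M0 xM; apply: le_trans (bN x M cx M0 xM) _.
  by rewrite ler_wpM2r// ltW.
pose q : R := 3^-1.
have q0 k : 0 < q ^+ k by rewrite exprn_gt0// invr_gt0.
pose bump (sg : bool) k (x : R -> R) u := x u + (-1) ^+ sg * q ^+ k * (p k).2 u.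
(* The two candidates differ by twice the bump q^k u, so at least one of them has an image no
   smaller than that of the bump; the larger one is kept. *)
pose next k (x : R -> R) := if `|L (p k).1.1 (bump false k x)| <=
  `|L (p k).1.1 (bump true k x)| then bump true k x else bump false k x.
pose fix xs k : R -> R := if k is k'.+1 then next k' (xs k') else fun=> 0.
have nextE k x : exists b, next k x = bump b k x.
  by rewrite /next; case: ifP; [exists true|exists false].
have cu k : C0T T (p k).2 by have [_ _ _ [? _] _] := pP k.
have u1 k v : 0 <= v <= T -> `|(p k).2 v| <= 1 by have [_ _ _ [_ H] _] := pP k; exact: H.
have cxs k : C0T T (xs k).
  elim: k => [|k IH]; first exact: C0T_cst.
  by rewrite /=; have [b ->] := nextE k (xs k); apply: C0TD => //; exact: C0TZ.
have xsS k v : 0 <= v <= T -> `|xs k.+1 v - xs k v| <= q ^+ k.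
  move=> vT /=; have [b ->] := nextE k (xs k).
  rewrite /bump addrAC subrr add0r !normrM normr_sign mul1r (ger0_norm (ltW (q0 k))).
  by rewrite -[leRHS]mulr1 ler_wpM2l ?u1// ltW.
have Lxs k : 9 / 10 * (p k).1.2 * q ^+ k <= `|L (p k).1.1 (xs k.+1)|.
  have [Dk _ _ _ Lu] := pP k.
  have Lb b : L (p k).1.1 (bump b k (xs k)) =
      L (p k).1.1 (xs k) + (-1) ^+ b * (q ^+ k * L (p k).1.1 (p k).2).
    by rewrite mulrA -L_scale// -L_add//; exact: C0TZ.
  have h : 9 / 10 * (p k).1.2 * q ^+ k <= `|q ^+ k * L (p k).1.1 (p k).2|.
    by rewrite normrM ger0_norm ?(ltW (q0 k))// mulrC ler_wpM2l// ltW.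
  have EA := Lb false; have EB := Lb true.
  rewrite expr0 mul1r in EA; rewrite expr1 mulN1r in EB.
  have := ler_normB (L (p k).1.1 (bump false k (xs k)))
    (L (p k).1.1 (bump true k (xs k))).
  rewrite (_ : _ - _ = (q ^+ k * L (p k).1.1 (p k).2) *+ 2); last first.
    by rewrite EA EB mulr2n; ring.
  rewrite normrMn mulr2n /= /next; case: ifP => [|/negbT]; rewrite -?ltNge; lra.
have xsD k m v : 0 <= v <= T ->
    `|xs (k + m)%N v - xs k v| <= 3 / 2 * q ^+ k * (1 - q ^+ m).
  move=> vT; elim: m => [|m IH]; first by rewrite addn0 !subrr normr0 mulr0.
  rewrite addnS; have := xsS (k + m)%N v vT.
  rewrite exprD exprS (_ : 1 - q * q ^+ m = (1 - q ^+ m) + 2 / 3 * q ^+ m);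
    last by rewrite /q; field.
  move=> h; rewrite (_ : xs (k + m).+1 v - xs k v =
    (xs (k + m).+1 v - xs (k + m)%N v) + (xs (k + m)%N v - xs k v)); last by ring.
  apply: le_trans (ler_normD _ _) _; apply: le_trans (lerD h IH) _.
  by rewrite le_eqVlt; apply/orP; left; apply/eqP; field.
have xsN k m v : 0 <= v <= T -> (k <= m)%N -> `|xs m v - xs k v| <= 3 / 2 * q ^+ k.
  move=> vT km; rewrite -(subnKC km); apply: le_trans (xsD _ _ _ vT) _.
  rewrite -[leRHS]mulr1 ler_wpM2l//; last by have := q0 (m - k)%N; lra.
  by have := q0 k; lra.
have qe (e : R) : 0 < e -> exists k, 3 / 2 * q ^+ k < e.
  move=> e0; have : q ^+ k @[k --> \oo] --> (0 : R).
    by apply: cvg_expr; rewrite ger0_norm /q; lra.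
  move=> /cvgrPdist_lt/(_ (e / 2) ltac:(lra))[N _ /(_ N (leqnn _))].
  by rewrite sub0r normrN (ger0_norm (ltW (q0 N))) => h; exists N; lra.
pose x v := lim (xs k v @[k --> \oo]).
have xcv v : 0 <= v <= T -> xs k v @[k --> \oo] --> x v.
  move=> vT; apply: R_complete; apply/cauchy_ballP => e e0.
  have [k ke] := qe (e / 2) ltac:(lra).
  exists ([set r | `|r - xs k v| < e / 2], [set r | `|r - xs k v| < e / 2]).
    by split; exists k => // n /= kn; apply: le_lt_trans (xsN _ _ _ vT kn) ke.
  move=> [r1 r2] /= [h1 h2]; rewrite /ball/=.
  rewrite (_ : r1 - r2 = (r1 - xs k v) - (r2 - xs k v)); last by ring.
  by apply: le_lt_trans (ler_normB _ _) _; lra.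
have xxs k v : 0 <= v <= T -> `|x v - xs k v| <= 3 / 2 * q ^+ k.
  move=> vT; have cv : (xs n v - xs k v) @[n --> \oo] --> x v - xs k v.
    by apply: cvgB; [exact: xcv|exact: cvg_cst].
  apply: (cvgr_norm_le cv); near=> n; apply: xsN => //; near: n.
  exact: nbhs_infty_ge.
have cx : C0T T x.
  apply/within_continuousP => u uT e e0.
  have [k ke] := qe (e / 3) ltac:(lra).
  have /within_continuousP/(_ u uT (e / 3))[|d d0 dP] := cxs k; first lra.
  exists d => // v vT uv; have h := dP v vT uv.
  have hu := xxs k u uT; have hv := xxs k v vT.
  rewrite (_ : x u - x v = (x u - xs k u) + (xs k u - xs k v) - (x v - xs k v));
    last by ring.
  apply: le_lt_trans (ler_normB _ _) _.
  by have := ler_normD (x u - xs k u) (xs k u - xs k v); lra.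
have [A AP] := L_pointwise_bnd cx.
(* With N the norm in [p k], the k-th move secures 9/10 N q^k. The later moves have total size at
   most 3/2 q^(k+1) = q^k / 2 and so lose at most half of N q^k. As N > k 3^k, at least 2/5 k is
   left. *)
have low k : 2 / 5 * k%:R <= A.
  have [Dk bk Nk _ _] := pP k.
  apply: le_trans (AP _ Dk).
  have cd : C0T T (fun v => x v + -1 * xs k.+1 v) by apply: C0TD => //; exact: C0TZ.
  have qS : 0 < 3 / 2 * q ^+ k.+1 by have := q0 k.+1; lra.
  have h : `|L (p k).1.1 x - L (p k).1.1 (xs k.+1)| <= (p k).1.2 * q ^+ k / 2.
    have := bk _ _ cd qS; rewrite L_add//; last exact: C0TZ.
    rewrite L_scale// mulN1r (_ : _ * (3 / 2 * _) = (p k).1.2 * q ^+ k / 2).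
      by apply=> u uT; rewrite mulN1r; exact: xxs.
    by rewrite exprS /q; field.
  have Lk := Lxs k.
  have := ler_normB (L (p k).1.1 x) (L (p k).1.1 x - L (p k).1.1 (xs k.+1)).
  rewrite subKr => tri.
  have qk : k%:R = k%:R * 3 ^+ k * q ^+ k :> R.
    by rewrite -mulrA -exprMn /q divff ?expr1n ?mulr1.
  have : k%:R * 3 ^+ k * q ^+ k <= (p k).1.2 * q ^+ k by rewrite ler_wpM2r// ltW.
  by rewrite -qk; rewrite -mulrA in Lk; lra.
have := low (Num.bound (A * (5 / 2))).
have A0 : 0 <= A by have := low 0%N; rewrite mulr0.
have := archi_boundP (mulr_ge0 A0 (_ : 0 <= 5 / 2)); move=> /(_ ltac:(lra)).
by lra.
Unshelve. all: by end_near. Qed.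

End uniform_boundedness.

(** * Optional stopping *)

Section expectation.
Context {R : realType} {d : measure_display} {Omega : measurableType d}.
Variable P : probability Omega R.
Implicit Types (f g : Omega -> R) (A : set Omega).

Local Notation summable f := (P.-integrable setT (EFin \o (f : Omega -> R))).

Definition mean f : R := \int[P]_w f w.

Lemma summable_measurable f : summable f -> measurable_fun setT f.
Proof. by move=> /measurable_int/measurable_EFinP. Qed.

Lemma summableD f g : summable f -> summable g -> summable (fun w => f w + g w).
Proof.
move=> sf sg; have := integrableD measurableT sf sg.
by apply: eq_integrable => // w _.
Qed.

Lemma summable_le f g : measurable_fun setT f -> (forall w, `|f w| <= `|g w|) ->
  summable g -> summable f.
Proof.
move=> mf fg; apply: le_integrable => //; first exact/measurable_EFinP.
by move=> w _ /=; rewrite lee_fin.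
Qed.

Lemma summableM1 f A : measurable A -> summable f ->
  summable (fun w => f w * \1_A w).
Proof.
move=> mA sf; apply: (summable_le _ _ sf).
  apply: measurable_funM; first exact: summable_measurable.
  exact: measurable_indic.
by move=> w; rewrite normrM indicE; case: (_ \in _); rewrite ?normr1 ?mulr1// normr0 mulr0.
Qed.

Lemma summable_cst k : summable (fun=> k).
Proof. exact: finite_measure_integrable_cst. Qed.

Lemma summable_bounded c f : measurable_fun setT f -> (forall w, `|f w| <= c) ->
  summable f.
Proof.
move=> mf fc; apply: (summable_le mf _ (summable_cst c)) => w.
by rewrite (le_trans (fc w))// ler_norm.
Qed.

Lemma summable_norm f : summable f -> summable (fun w => `|f w|).
Proof. exact: integrable_norm. Qed.

Lemma summable_sum n (f : nat -> Omega -> R) : (forall i, summable (f i)) ->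
  summable (fun w => \sum_(0 <= i < n) f i w).
Proof.
move=> sf; elim: n => [|n IH].
  by apply: eq_integrable (summable_cst 0) => // w _ /=; rewrite big_nil.
by apply: eq_integrable (summableD IH (sf n)) => // w _ /=; rewrite big_nat_recr.
Qed.

Lemma eq_mean f g : f =1 g -> mean f = mean g.
Proof. by move=> fg; apply: eq_Rintegral => w _; exact: fg. Qed.

Lemma meanD f g : summable f -> summable g ->
  mean (fun w => f w + g w) = mean f + mean g.
Proof. by move=> sf sg; exact: RintegralD. Qed.

Lemma meanB f g : summable f -> summable g ->
  mean (fun w => f w - g w) = mean f - mean g.
Proof. by move=> sf sg; exact: RintegralB. Qed.

Lemma mean_sum n (f : nat -> Omega -> R) : (forall i, summable (f i)) ->
  mean (fun w => \sum_(0 <= i < n) f i w) = \sum_(0 <= i < n) mean (f i).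
Proof.
move=> sf; elim: n => [|n IH].
  rewrite big_nil (eq_mean (g := fun=> 0)); last by move=> w; rewrite big_nil.
  by rewrite /mean Rintegral_cst// mul0r.
rewrite big_nat_recr//= -IH -meanD//; last exact: summable_sum.
by apply: eq_mean => w; rewrite big_nat_recr.
Qed.

Lemma le_mean f g : summable f -> summable g -> (forall w, f w <= g w) ->
  mean f <= mean g.
Proof. by move=> sf sg fg; apply: le_Rintegral. Qed.

Lemma le_norm_mean f : summable f -> `|mean f| <= mean (fun w => `|f w|).
Proof. by move=> sf; exact: le_normr_Rintegral. Qed.

Lemma mean_EFin f : summable f -> (\int[P]_w (f w)%:E = (mean f)%:E)%E.
Proof. by move=> sf; rewrite /mean /Rintegral fineK// integrable_fin_num. Qed.

Lemma integral_mean1 f A : measurable A -> summable f ->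
  (\int[P]_(w in A) (f w)%:E = (mean (fun w => f w * \1_A w))%:E)%E.
Proof.
move=> mA sf; rewrite -mean_EFin; last exact: summableM1.
rewrite integral_mkcond; apply: eq_integral => w _.
by rewrite patchE indicE; case: (_ \in _); rewrite ?mulr1 ?mulr0.
Qed.

Lemma mean_dominated (f_ : nat -> Omega -> R) f g :
  (forall n, measurable_fun setT (f_ n)) -> measurable_fun setT f ->
  (forall w, f_ n w @[n --> \oo] --> f w) -> summable g ->
  (forall n w, `|f_ n w| <= g w) -> mean (f_ n) @[n --> \oo] --> mean f.
Proof.
move=> mf_ mf f_f sg f_g.
have [] := @dominated_convergence _ _ _ P setT measurableT
  (fun n => EFin \o f_ n) (EFin \o f) (EFin \o g) _ _ _ sg _.
- by move=> n; exact/measurable_EFinP.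
- exact/measurable_EFinP.
- by apply: aeW => w _ /=; apply: cvg_EFin; [exact: nearW|exact: f_f].
- by apply: aeW => w n _ /=; rewrite lee_fin.
move=> sf _ h; apply: fine_cvg; rewrite [X in _ --> X](_ : _ = (\int[P]_w (f w)%:E)%E)//.
by rewrite -[RHS]fineK// integrable_fin_num.
Qed.

Lemma mean_fatou (f_ : nat -> Omega -> R) f c :
  (forall n, summable (f_ n)) -> measurable_fun setT f ->
  (forall w, f_ n w @[n --> \oo] --> f w) ->
  (forall n, mean (fun w => `|f_ n w|) <= c) ->
  summable f /\ mean (fun w => `|f w|) <= c.
Proof.
move=> sf_ mf f_f f_c.
have key : (\int[P]_w `|(f w)%:E| <= c%:E)%E.
  have := @fatou _ _ _ P setT measurableT (fun n w => `|(f_ n w)%:E|%E) _ _.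
  rewrite (eq_integral (fun w => `|(f w)%:E|%E)); last first.
    move=> w _; have cv : (`|(f_ n w)%:E|)%E @[n --> \oo] --> `|(f w)%:E|%E.
      by apply: cvg_abse; apply: cvg_EFin; [exact: nearW|exact: f_f].
    by rewrite is_cvg_limn_einfE; [exact/cvg_lim|apply/cvg_ex; eexists; exact: cv].
  move=> /(_ _ _)/le_trans; apply=> //.
    move=> n; apply: measurableT_comp => //; apply/measurable_EFinP.
    exact: summable_measurable.
  rewrite limn_einf_lim; apply: lime_le; first exact: is_cvg_einfs.
  apply: nearW => n; apply: (@le_trans _ _ (mean (fun w => `|f_ n w|))%:E);
    last by rewrite lee_fin.
  rewrite -mean_EFin; last exact: summable_norm.
  by apply: ereal_inf_lbound => /=; exists n => /=.
have sf : summable f.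
  apply/integrableP; split; first exact/measurable_EFinP.
  by apply: le_lt_trans key _; exact: ltry.
by split=> //; rewrite -lee_fin -mean_EFin//; exact: summable_norm.
Qed.

End expectation.

Arguments eq_mean {R d Omega P f g}.

(** * Passage to the limit under uniform integrability *)

Section uniform_integrability.
Context {R : realType} {d : measure_display} {Omega : measurableType d}.
Variable P : probability Omega R.

Local Notation summable f := (P.-integrable setT (EFin \o (f : Omega -> R))).

Lemma measurable_soft (k : R) : 0 <= k -> measurable_fun setT (soft k).
Proof.
move=> k0; apply: continuous_measurable_fun => y; apply/cvgrPdist_lt => e e0.
near=> z; apply: le_lt_trans (soft_lip y z k0) _.
by near: z; apply/nbhs_ballP; exists e.
Unshelve. all: by end_near. Qed.

(* Vitali's theorem, the uniform integrability being expressed through the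
   excess of [X_ n] over a level. *)
Lemma mean_uniformly_integrable (X_ : nat -> Omega -> R) (X : Omega -> R) (eta : nat -> R) :
  (forall n, summable (X_ n)) -> measurable_fun setT X ->
  (forall w, X_ n w @[n --> \oo] --> X w) ->
  (forall k n, mean P (fun w => `|soft k%:R (X_ n w)|) <= eta k) ->
  eta k @[k --> \oo] --> (0 : R) ->
  summable X /\ forall A m, measurable A ->
    (forall n, mean P (fun w => X_ n w * \1_A w) = m) ->
    mean P (fun w => X w * \1_A w) = m.
Proof.
move=> sX_ mX X_X etaP eta0.
have msoft k (Y : Omega -> R) : measurable_fun setT Y ->
    measurable_fun setT (fun w => soft (k%:R : R) (Y w)).
  by move=> mY; apply: measurableT_comp mY; apply: measurable_soft; exact: ler0n.
have ssoft k (Y : Omega -> R) : summable Y -> summable (fun w => soft (k%:R : R) (Y w)).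
  move=> sY; apply: (summable_le _ _ sY).
    by apply: msoft; exact: (summable_measurable sY).
  by move=> w; apply: soft_norm; exact: ler0n.
have csoft k w : soft (k%:R : R) (X_ n w) @[n --> \oo] --> soft k%:R (X w).
  apply/cvgrPdist_lt => e e0; have /cvgrPdist_lt/(_ e e0) := X_X w.
  apply: filterS => n; apply: le_lt_trans; exact: soft_lip.
have sX : summable X.
  (* At level 0 [soft] is the identity, so [eta 0] bounds the first absolute moments. *)
  have [] // := @mean_fatou _ _ _ P X_ X (eta 0%N) sX_ mX X_X.
  move=> n; apply: le_trans (etaP 0%N n); rewrite le_eqVlt; apply/orP; left.
  apply/eqP/eq_mean => w; congr (`| _ |); rewrite /soft.
  by case: ltP => h1; [|case: ltP => h2]; lra.
split=> // A m mA Xm.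
have Xk k : mean P (fun w => `|soft k%:R (X w)|) <= eta k.
  have [] // := @mean_fatou _ _ _ P (fun n w => soft k%:R (X_ n w))
    (fun w => soft k%:R (X w)) (eta k).
  - by move=> n; exact: ssoft.
  - exact: msoft.
have softA k (Y : Omega -> R) c : summable Y -> mean P (fun w => `|soft k%:R (Y w)|) <= c ->
    `|mean P (fun w => soft k%:R (Y w) * \1_A w)| <= c.
  move=> sY; apply: le_trans; have sS := ssoft k _ sY.
  apply: le_trans (le_norm_mean (summableM1 mA sS)) _.
  apply: le_mean; [exact/summable_norm/summableM1|exact: summable_norm|].
  by move=> w; rewrite normrM indicE; case: (_ \in _); rewrite ?normr1 ?mulr1// normr0 mulr0.
pose clip (k : nat) (y : R) := y - soft k%:R y.
have sclip k (Y : Omega -> R) : summable Y -> summable (fun w => clip k (Y w) * \1_A w).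
  move=> sY; apply: summableM1 => //.
  by apply: eq_integrable (integrableB measurableT sY (ssoft k _ sY)).
have split_mean k (Y : Omega -> R) : summable Y -> mean P (fun w => Y w * \1_A w) =
    mean P (fun w => clip k (Y w) * \1_A w) + mean P (fun w => soft k%:R (Y w) * \1_A w).
  move=> sY; rewrite -meanD; [|exact: sclip|exact/summableM1/ssoft].
  by apply: eq_mean => w; rewrite /clip -mulrDl subrK.
(* The clipped part is bounded by [k], so dominated convergence applies to it; the excesses of the
   limit and of the sequence cost [eta k] each. *)
have bound k : `|mean P (fun w => X w * \1_A w) - m| <= 2 * eta k.
  have cl : mean P (fun w => clip k (X_ n w) * \1_A w) @[n --> \oo] -->
      mean P (fun w => clip k (X w) * \1_A w).
    apply: (@mean_dominated _ _ _ P _ _ (fun=> k%:R)).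
    - by move=> n; exact/summable_measurable/sclip.
    - exact/summable_measurable/sclip.
    - by move=> w; apply: cvgMl; apply: cvgB => //.
    - exact: summable_cst.
    move=> n w; rewrite normrM -[leRHS]mulr1 ler_pM//; first exact: soft_dist.
    by rewrite indicE; case: (_ \in _); rewrite ?normr1// normr0 ler01.
  apply/ler_addgt0Pr => e e0; have /cvgrPdist_lt/(_ e e0)[N _ /(_ N (leqnn N))] := cl.
  have := softA k _ _ sX (Xk k); have := softA k _ _ (sX_ N) (etaP k N).
  rewrite -(Xm N) (split_mean k _ sX) (split_mean k _ (sX_ N)) /=.
  by rewrite !ler_norml ltr_norml; lra.
apply/eqP; rewrite -subr_eq0 -normr_le0; apply/ler_addgt0Pr => e e0.
have /cvgrPdist_lt/(_ (e / 2) ltac:(lra))[k _ /(_ k (leqnn k))] := eta0.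
by rewrite sub0r normrN => /ltr_normlW h; have := bound k; rewrite add0r; lra.
Qed.

End uniform_integrability.

(** * Measurability with respect to the filtration *)

Section filtration.
Context {R : realType} {d : measure_display} {Omega : measurableType d}.
Variables (P : probability Omega R) (Fil : R -> set (set Omega)).
Hypothesis Fil_usual : usual_filtration P Fil.

(** The space is retyped with the sigma-algebra generated by [Fil t], which is [Fil t] itself for t
    >= 0 ([filE]), so that the general lemmas on measurable functions apply. *)
Definition fil_measurable (t : R) (f : Omega -> R) : Prop :=
  measurable_fun setT (f : g_sigma_algebraType (Fil t) -> R).

Lemma filE t : 0 <= t -> (Fil t).-sigma.-measurable = Fil t.
Proof.
case: Fil_usual => H _ _ _ t0; apply: measurable_g_measurableTypeE.
exact: (proj1 (H t t0)).
Qed.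

Lemma fil_sub t A : 0 <= t -> Fil t A -> measurable A.
Proof. by case: Fil_usual => H _ _ _ t0; exact: (proj2 (H t t0)). Qed.

Lemma fil_mono s t A : 0 <= s -> s <= t -> Fil s A -> Fil t A.
Proof. by case: Fil_usual => _ H _ _ s0 st; exact: H. Qed.

Lemma filI t A B : 0 <= t -> Fil t A -> Fil t B -> Fil t (A `&` B).
Proof. by move=> t0; rewrite -filE//; exact: measurableI. Qed.

Lemma filC t A : 0 <= t -> Fil t A -> Fil t (~` A).
Proof. by move=> t0; rewrite -filE//; exact: measurableC. Qed.

Lemma filU t A B : 0 <= t -> Fil t A -> Fil t B -> Fil t (A `|` B).
Proof. by move=> t0; rewrite -filE//; exact: measurableU. Qed.

Lemma adaptedP (X : R -> Omega -> R) :
  adapted Fil X <-> forall t, 0 <= t -> fil_measurable t (X t).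
Proof.
split=> H t t0; last first.
  by move=> B mB; rewrite -filE// -[X in measurable X]setTI; exact: (H t t0).
by move=> _ B mB; rewrite setTI filE//; exact: H.
Qed.

Lemma fil_measurable_mono s t f : 0 <= s -> s <= t ->
  fil_measurable s f -> fil_measurable t f.
Proof.
move=> s0 st mf _ B mB; have := mf measurableT B mB.
by rewrite !setTI !filE ?(le_trans s0 st)//; exact: fil_mono.
Qed.

Lemma fil_measurable_measurable t f : 0 <= t -> fil_measurable t f ->
  measurable_fun setT f.
Proof.
move=> t0 mf _ B mB; have := mf measurableT B mB.
by rewrite !setTI filE//; exact: fil_sub.
Qed.

Lemma fil_measurableD t f g : fil_measurable t f -> fil_measurable t g ->
  fil_measurable t (fun w => f w + g w).
Proof. by move=> mf mg; exact: measurable_funD. Qed.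

Lemma fil_measurableM t f g : fil_measurable t f -> fil_measurable t g ->
  fil_measurable t (fun w => f w * g w).
Proof. by move=> mf mg; exact: measurable_funM. Qed.

Lemma fil_measurable_cst t k : fil_measurable t (fun=> k).
Proof. exact: measurable_cst. Qed.

Lemma fil_measurable_indic t A : 0 <= t -> Fil t A -> fil_measurable t (\1_A).
Proof.
move=> t0; rewrite -filE// => mA.
exact: (@measurable_indic _ (g_sigma_algebraType (Fil t))).
Qed.

Lemma fil_measurable_sum t n (f : nat -> Omega -> R) :
  (forall i, (i < n)%N -> fil_measurable t (f i)) ->
  fil_measurable t (fun w => \sum_(0 <= i < n) f i w).
Proof.
elim: n => [|n IH] H.
  rewrite (_ : (fun _ => _) = fun=> 0); first exact: fil_measurable_cst.
  by apply/funext => w; rewrite big_nil.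
rewrite (_ : (fun _ => _) = fun w => \sum_(0 <= i < n) f i w + f n w); last first.
  by apply/funext => w; rewrite big_nat_recr.
by apply: fil_measurableD; [apply: IH => i /ltnW; exact: H|exact: H].
Qed.

Lemma fil_measurable_lim t (f_ : nat -> Omega -> R) f :
  (forall n, fil_measurable t (f_ n)) -> (forall w, f_ n w @[n --> \oo] --> f w) ->
  fil_measurable t f.
Proof.
move=> mf_ f_f.
apply: (@measurable_fun_cvg _ (g_sigma_algebraType (Fil t)) R setT f_ f) => //.
Qed.

Lemma stopping_lt t sigma : 0 <= t -> stopping_time Fil sigma ->
  Fil t [set w | (t%:E < sigma w)%E].
Proof.
move=> t0 [_ S]; rewrite (_ : [set _ | _] = ~` [set w | (sigma w <= t%:E)%E]).
  by apply: filC => //; exact: S.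
by apply/seteqP; split=> w /=; rewrite ltNge => /negP.
Qed.

End filtration.

(** * Stopping continuous martingales and localizing sums *)

Section optional_stopping.
Context {R : realType} {d : measure_display} {Omega : measurableType d}.
Variables (P : probability Omega R) (Fil : R -> set (set Omega)).
Hypothesis Fil_usual : usual_filtration P Fil.

Local Notation summable f := (P.-integrable setT (EFin \o (f : Omega -> R))).
Implicit Types (M : R -> Omega -> R) (sigma : Omega -> \bar R).

Lemma martingale_summable M t : martingale P Fil M -> 0 <= t -> summable (M t).
Proof. by move=> [_ H _] t0; have := H t t0. Qed.

Lemma martingaleP M : martingale P Fil M <->
  [/\ adapted Fil M, forall t, 0 <= t -> summable (M t) &
    forall s t, 0 <= s -> s <= t -> forall A, Fil s A ->
      mean P (fun w => M t w * \1_A w) = mean P (fun w => M s w * \1_A w)].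
Proof.
have E M' s t A : (forall t, 0 <= t -> summable (M' t)) -> 0 <= s -> s <= t ->
    Fil s A -> (\int[P]_(w in A) (M' t w)%:E = \int[P]_(w in A) (M' s w)%:E)%E <->
    mean P (fun w => M' t w * \1_A w) = mean P (fun w => M' s w * \1_A w).
  move=> sM s0 st FA; have mA := fil_sub Fil_usual s0 FA.
  have t0 := le_trans s0 st.
  rewrite !integral_mean1//; [|exact: sM|exact: sM].
  by split=> [[]|->].
split=> -[aM sM HM]; split=> // s t s0 st A FA; first exact/(E _ _ _ _ sM s0 st FA)/HM.
exact/(E _ _ _ _ sM s0 st FA)/HM.
Qed.

(** The absolute value of a martingale is a submartingale: where [M s] has a constant sign, the
    martingale property replaces it by [M t], which with that sign is at most its absolute value. *)
Lemma martingale_norm_le M s t A : martingale P Fil M -> 0 <= s -> s <= t ->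
  Fil s A -> mean P (fun w => `|M s w| * \1_A w) <= mean P (fun w => `|M t w| * \1_A w).
Proof.
move=> /martingaleP[aM sM HM] s0 st FA; have t0 := le_trans s0 st.
pose Ap := A `&` [set w | 0 <= M s w]; pose An := A `&` ~` [set w | 0 <= M s w].
have Fp : Fil s [set w | 0 <= M s w].
  have := aM s s0 [set y | 0 <= y]; apply.
  by rewrite (_ : [set y | _] = `[0, +oo[%classic)//; apply/seteqP; split=> y;
    rewrite /= in_itv/= andbT.
have FAp : Fil s Ap by apply: (filI Fil_usual).
have FAn : Fil s An by apply: (filI Fil_usual) => //; exact: (filC Fil_usual).
have [mA mAp mAn] : [/\ measurable A, measurable Ap & measurable An].
  by split; exact: (fil_sub Fil_usual s0).
have inE w : (w \in [set w | 0 <= M s w]) = (0 <= M s w).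
  by apply/idP/idP => [/set_mem|/mem_set].
rewrite (eq_mean (g := fun w => M s w * \1_Ap w - M s w * \1_An w)); last first.
  move=> w; rewrite /Ap /An !indicI indicC /= !indicE inE.
  by case: (w \in A); case: (leP 0 (M s w)) => h;
    rewrite ?(ger0_norm h) ?(ltr0_norm h) /=; ring.
have ss t' B : 0 <= t' -> measurable B -> summable (fun w => M t' w * \1_B w).
  by move=> t'0 mB; apply: summableM1 => //; exact: sM.
rewrite meanB; [|exact: ss|exact: ss].
rewrite -(HM s t)// -(HM s t)// -meanB; [|exact: ss|exact: ss].
apply: le_mean.
- by apply: (integrableB measurableT (ss _ _ t0 mAp) (ss _ _ t0 mAn)).
- by apply: summableM1 => //; exact/summable_norm/sM.
move=> w; rewrite /Ap /An !indicI indicC /= !indicE.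
have := ler_norm (M t w); have := ler_norm (- M t w); rewrite normrN.
by case: (w \in A); case: (w \in [set w | 0 <= M s w]) => /=; lra.
Qed.

Section stopping.
Variables (M : R -> Omega -> R) (sigma : Omega -> \bar R).
Hypothesis M_martingale : martingale P Fil M.
Hypothesis M_continuous : continuous_paths M.
Hypothesis sigma_stopping : stopping_time Fil sigma.

Section grid.
Variables s t : R.
Hypotheses (s_ge0 : 0 <= s) (st : s < t).

Let p (n i : nat) : R := s + (t - s) * i%:R / n.+1%:R.

Let p0 n : p n 0%N = s.
Proof. by rewrite /p mulr0 mul0r addr0. Qed.

Let pS n : p n n.+1 = t.
Proof. by rewrite /p -mulrA divff// mulr1 addrC subrK. Qed.

Let p_le n i j : (i <= j)%N -> p n i <= p n j.
Proof.
move=> ij; rewrite /p lerD2l ler_wpM2r ?invr_ge0// ler_wpM2l ?subr_ge0 ?(ltW st)//.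
by rewrite ler_nat.
Qed.

Let p_ge0 n i : 0 <= p n i.
Proof. by rewrite (le_trans s_ge0)// -[leLHS](p0 n) p_le. Qed.

Let p_let n i : (i <= n)%N -> p n i.+1 <= t.
Proof. by move=> ?; rewrite -[leRHS](pS n) p_le. Qed.

Let p_step n i : p n i.+1 - p n i = (t - s) / n.+1%:R.
Proof. by rewrite /p -natr1; ring. Qed.

Let past u : set Omega := [set w | (u%:E < sigma w)%E].

(** For i <= n, the event that the minimum of [sigma] and [t] falls between [p n i] (excluded) and
    [p n i.+1] (included). These events partition [past s]; the last one also collects the paths not
    stopped by time [t]. *)
Let cell n i : set Omega :=
  if i == n then past (p n i) else past (p n i) `\` past (p n i.+1).

Let grid_sum n (a : nat -> R) w : R := \sum_(0 <= i < n.+1) a i * \1_(cell n i) w.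

Let grid_sumE n w : past s w -> exists i, [/\ (i <= n)%N, cell n i w &
  forall a, grid_sum n a w = a i].
Proof.
move=> sw; have ex : exists i, (i <= n)%N && `[< past (p n i) w >].
  by exists 0%N; rewrite /=; apply/asboolP; rewrite /past p0.
have ub i : (i <= n)%N && `[< past (p n i) w >] -> (i <= n)%N by case/andP.
case: (ex_maxnP ex ub) => i /andP[iN /asboolP iw] imax.
have ci : cell n i w.
  rewrite /cell; case: eqP => // /eqP i_n; split=> // h.
  have /imax : (i < n)%N && `[< past (p n i.+1) w >].
    by rewrite ltn_neqAle i_n iN/=; apply/asboolP.
  by rewrite ltnn.
exists i; split=> // a; rewrite /grid_sum big_mkord.
rewrite (bigD1 (Ordinal (iN : (i < n.+1)%N)))//= indicE mem_set// mulr1.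
rewrite big1 ?addr0// => j ji; rewrite indicE memNset ?mulr0//.
have {}ji : (j : nat) != i by apply: contraNN ji => /eqP ji; apply/eqP/val_inj.
have jn : (j <= n)%N by rewrite -ltnS.
move=> cj; have jw : past (p n j) w by move: cj; rewrite /cell; case: eqP => // _ [].
have ji' : (j < i)%N.
  rewrite ltn_neqAle ji/=; apply: imax; rewrite jn/=; exact/asboolP.
have jNn : (j : nat) == n = false by apply/negbTE; rewrite neq_ltn (leq_trans ji' iN).
move: cj; rewrite /cell jNn => -[_]; apply; apply: le_lt_trans iw.
by rewrite lee_fin p_le.
Qed.

Let grid_sum0 n a w : ~ past s w -> grid_sum n a w = 0.
Proof.
move=> sw; rewrite /grid_sum big1// => i _; rewrite indicE memNset ?mulr0//.
have h : ~ past (p n i) w.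
  by move=> h; apply: sw; apply: le_lt_trans h; rewrite lee_fin -[leLHS](p0 n) p_le.
by rewrite /cell; case: eqP => // _ [].
Qed.

Let fil_past u : 0 <= u -> Fil u (past u).
Proof. by move=> u0; exact: (stopping_lt Fil_usual). Qed.

Let fil_cell n i : Fil (p n i.+1) (cell n i).
Proof.
have h : Fil (p n i.+1) (past (p n i)).
  by apply: (fil_mono Fil_usual) (p_ge0 n i) (p_le _ (leqnSn i)) (fil_past _).
rewrite /cell; case: eqP => // _; rewrite setDE; apply: (filI Fil_usual) => //.
by apply: (filC Fil_usual) => //; exact: fil_past.
Qed.

Let mcell n i : measurable (cell n i).
Proof. exact: (fil_sub Fil_usual (p_ge0 n i.+1)). Qed.

(** The martingale is read at the right end of the cell: by then the cell is known ([fil_cell]), so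
    [sigma] is approximated from above by grid-valued stopping times. *)
Let X n w := grid_sum n (fun i => M (p n i.+1) w) w.

Let sM u : 0 <= u -> summable (M u).
Proof. exact: martingale_summable. Qed.

Let t_ge0 : 0 <= t. Proof. exact: le_trans (ltW st). Qed.

Let sX n : summable (X n).
Proof. by apply: summable_sum => i; apply: summableM1 => //; exact: sM. Qed.

Let filX n : fil_measurable Fil t (X n).
Proof.
have [aM _ _] := M_martingale.
apply: fil_measurable_sum => i iN; apply: fil_measurableM.
  apply: (fil_measurable_mono Fil_usual (p_ge0 n i.+1)); first exact: p_let.
  exact: (proj1 (adaptedP Fil_usual M)).
apply: (fil_measurable_indic Fil_usual) => //.
by apply: (fil_mono Fil_usual) (fil_cell n i); [exact: p_ge0|exact: p_let].
Qed.

(** The martingale property is at stake only on the event that [sigma] exceeds [s]; elsewhere the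
    stopped process is already frozen at time [s]. *)
Definition stopped_after w := stopped M sigma t w * \1_(past s) w.

Let X_cvg w : X n w @[n --> \oo] --> stopped_after w.
Proof.
rewrite /stopped_after indicE; have [sw|sw] := boolP (w \in past s); last first.
  rewrite mulr0 (_ : (fun n => X n w) = fun=> 0); first exact: cvg_cst.
  by apply/funext => n; rewrite /X grid_sum0// => /mem_set; rewrite (negbTE sw).
move/set_mem in sw; rewrite mulr1 /stopped.
set r := fine _; have rE : r%:E = Order.min t%:E (sigma w).
  rewrite fineK// minElt; case: ifPn => //; rewrite -leNgt => h.
  rewrite fin_numElt (le_lt_trans h (ltry t)) andbT.
  exact: lt_le_trans (ltNyr 0) (proj1 sigma_stopping w).
have sr : s < r by rewrite -lte_fin rE lt_min lte_fin st.
have /within_continuousP/(_ r) := @M_continuous w.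
rewrite /= in_itv/= andbT => /(_ (ltW (le_lt_trans s_ge0 sr))) Mc.
apply/cvgrPdist_lt => e e0; have [dl dl0 dlP] := Mc e e0.
exists (Num.bound ((t - s) / dl)) => // n /= nN.
have [i [iN ci E]] := grid_sumE n sw; rewrite /X E.
apply: dlP; first by rewrite /= in_itv/= andbT.
have pr : p n i < r.
  rewrite -lte_fin rE lt_min; apply/andP; split.
    rewrite lte_fin (lt_le_trans _ (p_let iN))// -subr_gt0 p_step.
    by rewrite divr_gt0// subr_gt0.
  by move: ci; rewrite /cell; case: eqP => // _ [].
have rp : r <= p n i.+1.
  rewrite -lee_fin rE ge_min; move: ci; rewrite /cell; case: eqP => [->|_ [_]].
    by rewrite pS lexx.
  by move=> /negP; rewrite -leNgt => ->; rewrite orbT.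
rewrite ler0_norm ?subr_le0// opprB.
apply: (@le_lt_trans _ _ (p n i.+1 - p n i)); first by rewrite lerD2l lerN2 ltW.
rewrite p_step ltr_pdivrMr// mulrC -ltr_pdivrMr//.
apply: lt_le_trans (archi_boundP _) _.
  by rewrite divr_ge0 ?subr_ge0 ?(ltW st) ?(ltW dl0).
by rewrite ler_nat (leq_trans nN).
Qed.

(** A countable union over all grids at once: it is measurable, and it makes the bound [eta] on the
    excess independent of [n]. *)
Let large (k : nat) : set Omega :=
  \bigcup_n \bigcup_(i in [set i | (i <= n)%N]) [set w | k%:R < `|M (p n i.+1) w|].

Let fil_large u k : 0 <= u -> Fil u [set w | (k%:R : R) < `|M u w|].
Proof.
move=> u0; have [aM _ _] := M_martingale.
have := aM u u0 [set y | k%:R < `|y|]; apply.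
rewrite -[X in measurable X]setTI.
have mn : measurable_fun setT (fun y : R => `|y|) by exact: normr_measurable.
have := mn measurableT _ (measurable_itv `]k%:R, +oo[).
congr (measurable _); apply/seteqP; split=> y /=; rewrite in_itv/= andbT => //.
Qed.

Let mlarge k : measurable (large k).
Proof.
apply: bigcup_measurable => n _; apply: bigcup_measurable => i _.
by apply: (fil_sub Fil_usual (p_ge0 n i.+1)); exact: fil_large.
Qed.

Let eta k := mean P (fun w => `|M t w| * \1_(large k) w).

(** Each path is bounded on [s, t], hence leaves [large k] for large [k]; the absolute value of
    [M t] dominates. *)
Let eta_cvg : eta k @[k --> \oo] --> (0 : R).
Proof.
have sn : summable (fun w => `|M t w|) by exact/summable_norm/sM.
rewrite -[X in _ --> X](_ : mean P (fun=> 0) = 0); last first.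
  by rewrite /mean Rintegral_cst// mul0r.
apply: (@mean_dominated _ _ _ P _ _ (fun w => `|M t w|)) => //.
- by move=> k; apply: (@summable_measurable _ _ _ P); exact: summableM1.
- move=> w.
  have cM : {within `[s, t], continuous (M ^~ w)}.
    apply: continuous_subspaceW (@M_continuous w) => u /=.
    by rewrite !in_itv/= andbT => /andP[su _]; exact: le_trans su.
  have [C C0 CP] := segment_continuous_bounded cM.
  apply: (@cvg_near_cst _ _ _ _ _ _ _).
  exists (Num.bound C) => // k /= Ck; rewrite indicE memNset ?mulr0//.
  move=> [n _ [i /= iN]]; apply/negP; rewrite -leNgt.
  apply: le_trans (CP _ _) _.
    by rewrite p_let// andbT -[leLHS](p0 n) p_le.
  by rewrite (le_trans (ltW (archi_boundP C0)))// ler_nat.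
- by move=> k w; rewrite normrM normr_id indicE -[leRHS]mulr1 ler_wpM2l//;
    case: (_ \in _); rewrite ?normr1// normr0.
Qed.

(** The excess lives on the events [B i], which are decided at time [p n i.+1]. There
    [martingale_norm_le] moves the absolute value to the final time [t], and the disjoint [B i] are
    all contained in [large k]. *)
Let soft_X k n : mean P (fun w => `|soft k%:R (X n w)|) <= eta k.
Proof.
pose B i := cell n i `&` [set w | k%:R < `|M (p n i.+1) w|].
have fB i : Fil (p n i.+1) (B i) by apply: (filI Fil_usual) => //; exact: fil_large.
have mB i : measurable (B i) := fil_sub Fil_usual (p_ge0 n i.+1) (fB i).
have sMB u i : 0 <= u -> summable (fun w => `|M u w| * \1_(B i) w).
  by move=> u0; apply: summableM1 => //; exact/summable_norm/sM.
apply: (@le_trans _ _ (mean P (fun w =>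
    \sum_(0 <= i < n.+1) `|M (p n i.+1) w| * \1_(B i) w))).
  apply: le_mean.
  - apply/summable_norm/(summable_le _ _ (sX n)).
      by apply: measurableT_comp (summable_measurable (sX n)); exact: measurable_soft.
    by move=> w; exact: soft_norm.
  - by apply: summable_sum => i; exact: sMB.
  move=> w; rewrite [leRHS](_ : _ = grid_sum n (fun i => `|M (p n i.+1) w| *
      \1_[set w | k%:R < `|M (p n i.+1) w|] w) w); last first.
    by apply: eq_bigr => i _; rewrite /B indicI /=; ring.
  rewrite /X; have [sw|sw] := pselect (past s w); last first.
    by rewrite !grid_sum0// soft_eq0 ?normr0.
  have [i [iN ci E]] := grid_sumE n sw; rewrite !E indicE.
  have [h|h] := ltP k%:R `|M (p n i.+1) w|.
    by rewrite mem_set// mulr1; exact: soft_norm.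
  by rewrite soft_eq0// normr0 mulr_ge0.
rewrite mean_sum; last by move=> i; exact: sMB.
apply: (@le_trans _ _ (\sum_(0 <= i < n.+1) mean P (fun w => `|M t w| * \1_(B i) w))).
  rewrite big_nat [leRHS]big_nat; apply: ler_sum => i /andP[_ iN].
  by apply: martingale_norm_le => //; exact: p_let.
rewrite -mean_sum; last by move=> i; exact: sMB.
apply: le_mean.
- by apply: summable_sum => i; exact: sMB.
- by apply: summableM1 => //; exact/summable_norm/sM.
move=> w; rewrite [leLHS](_ : _ = grid_sum n (fun i => `|M t w| *
    \1_[set w | k%:R < `|M (p n i.+1) w|] w) w); last first.
  by apply: eq_bigr => i _; rewrite /B indicI /=; ring.
have [sw|sw] := pselect (past s w); last by rewrite grid_sum0// mulr_ge0.
have [i [iN ci E]] := grid_sumE n sw; rewrite !E ler_wpM2l// !indicE.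
have [h|_] := boolP (w \in [set w | k%:R < `|M (p n i.+1) w|]); last by rewrite ler0n.
by rewrite mem_set//; exists n => //; exists i => //; exact: set_mem h.
Qed.

(** For [A] in [Fil s], the part of [A] in a cell is decided at the right end of the cell, where [M]
    may be replaced by [M t]. Summing over the cells, the mean of [X n] on [A] does not depend on
    [n], and Vitali's theorem carries it to the limit. *)
Lemma stopped_afterP : [/\ fil_measurable Fil t stopped_after,
  summable stopped_after & forall A, Fil s A ->
  mean P (fun w => stopped_after w * \1_A w) =
  mean P (fun w => M s w * \1_(A `&` past s) w)].
Proof.
have mS : fil_measurable Fil t stopped_after.
  exact: (fil_measurable_lim filX X_cvg).
have [sS HS] := mean_uniformly_integrable sX
  (fil_measurable_measurable Fil_usual t_ge0 mS) X_cvg soft_X eta_cvg.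
split=> // A FA; have mA := fil_sub Fil_usual s_ge0 FA.
have [_ _ HM] := proj1 (martingaleP M) M_martingale.
have mps : measurable (past s) := fil_sub Fil_usual s_ge0 (fil_past s_ge0).
have FAs : Fil s (A `&` past s) by apply: (filI Fil_usual) => //; exact: fil_past.
apply: HS => // n.
have mcA i : measurable (cell n i `&` A) by exact: measurableI.
rewrite (eq_mean (g := fun w =>
    \sum_(0 <= i < n.+1) M (p n i.+1) w * \1_(cell n i `&` A) w)); last first.
  move=> w; rewrite /X /grid_sum mulr_suml; apply: eq_bigr => i _.
  by rewrite indicI /= mulrA.
rewrite mean_sum; last by move=> i; apply: summableM1 => //; exact: sM.
rewrite (eq_big_nat _ _ (F2 := fun i => mean P (fun w => M t w * \1_(cell n i `&` A) w)));
  last first.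
  move=> i /andP[_ iN]; apply/esym/HM => //; first exact: p_let.
  apply: (filI Fil_usual) => //; apply: (fil_mono Fil_usual s_ge0) FA.
  by rewrite -[leLHS](p0 n) p_le.
rewrite -mean_sum; last by move=> i; apply: summableM1 => //; exact: sM.
rewrite -(HM s t)//; last exact: ltW.
apply: eq_mean => w.
rewrite (_ : \sum_(_ <= _ < _) _ = grid_sum n (fun=> M t w) w * \1_A w); last first.
  by rewrite /grid_sum mulr_suml; apply: eq_bigr => i _; rewrite indicI /= mulrA.
rewrite indicI /= [X in _ = _ * X]mulrC mulrA; congr (_ * _).
have [sw|sw] := pselect (past s w).
  by have [i [_ _ ->]] := grid_sumE n sw; rewrite indicE mem_set// mulr1.
by rewrite grid_sum0// indicE memNset// mulr0.
Qed.

End grid.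

Lemma stopped0 w : stopped M sigma 0 w = M 0 w.
Proof.
by rewrite /stopped (_ : Order.min _ _ = 0%E)//; apply/min_idPl; exact: (proj1 sigma_stopping).
Qed.

Let split_stopped s t w : s <= t -> stopped M sigma t w =
  stopped M sigma s w * \1_(~` [set w | (s%:E < sigma w)%E]) w +
  stopped_after s t w.
Proof.
move=> st; rewrite /stopped_after indicC /= indicE.
have [sw|] := boolP (w \in _); first by rewrite /=; ring.
move=> /negP sw; rewrite [RHS](_ : _ = stopped M sigma s w) /=; last by ring.
rewrite /stopped.
have {}sw : (sigma w <= s%:E)%E by rewrite leNgt; apply/negP => h; apply/sw/mem_set.
rewrite (min_idPr sw) (min_idPr _)//.
by rewrite (le_trans sw)// lee_fin.
Qed.

Lemma stopped_martingale : martingale P Fil (stopped M sigma).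
Proof.
have [aM sM HM] := proj1 (martingaleP M) M_martingale.
have fpast u : 0 <= u -> Fil u (~` [set w | (u%:E < sigma w)%E]).
  by move=> u0; apply: (filC Fil_usual) => //; exact: (stopping_lt Fil_usual).
(* [stopped_afterP] needs a nondegenerate interval, here [0, t], so time 0 is treated apart. *)
have main t : 0 <= t -> fil_measurable Fil t (stopped M sigma t) /\
    summable (stopped M sigma t).
  rewrite le_eqVlt => /predU1P[<-|t0].
    rewrite (_ : stopped M sigma 0 = M 0); last by apply/funext => w; exact: stopped0.
    by split; [exact: (proj1 (adaptedP Fil_usual M) aM)|exact: sM].
  have [fA sA _] := stopped_afterP (lexx 0) t0.
  have F0 := fpast 0 (lexx 0).
  have -> : stopped M sigma t = fun w => M 0 w *
      \1_(~` [set w | (0%:E < sigma w)%E]) w + stopped_after 0 t w.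
    by apply/funext => w; rewrite (split_stopped _ (ltW t0)) stopped0.
  split.
    apply: fil_measurableD => //; apply: fil_measurableM.
      apply: (fil_measurable_mono Fil_usual (lexx 0) (ltW t0)).
      exact: (proj1 (adaptedP Fil_usual M)).
    apply: (fil_measurable_indic Fil_usual); first exact: ltW.
    exact: (fil_mono Fil_usual (lexx 0) (ltW t0)).
  apply: summableD => //; apply: summableM1; last exact: sM.
  exact: (fil_sub Fil_usual (lexx 0)).
apply/martingaleP; split.
- by apply/(adaptedP Fil_usual) => t t0; case: (main t t0).
- by move=> t t0; case: (main t t0).
move=> s t s0; rewrite le_eqVlt => /predU1P[<-//|st] A FA.
have [_ sA EA] := stopped_afterP s0 st.
have Fs := fpast s s0; have mA := fil_sub Fil_usual s0 FA.
have ms := fil_sub Fil_usual s0 Fs.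
have mps : measurable [set w | (s%:E < sigma w)%E].
  by apply: (fil_sub Fil_usual s0); exact: (stopping_lt Fil_usual).
have [_ ss] := main s s0.
pose f w := stopped M sigma s w * \1_(A `&` ~` [set w | (s%:E < sigma w)%E]) w.
have sf : summable f by apply: summableM1 => //; exact: measurableI.
transitivity (mean P f + mean P (fun w => stopped_after s t w * \1_A w)).
  rewrite -meanD//; last exact: summableM1.
  apply: eq_mean => w; rewrite (split_stopped _ (ltW st)) /f indicI /=; ring.
rewrite EA// -meanD//; last first.
  by apply: summableM1; [exact: measurableI|exact: sM].
apply: eq_mean => w; rewrite /f !indicI indicC /= !indicE.
have [sw|sw] := boolP (w \in [set w | (s%:E < sigma w)%E]); last by rewrite /=; ring.
have -> : stopped M sigma s w = M s w; last by rewrite /=; ring.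
by rewrite /stopped (min_idPl _)//; apply: ltW; exact: (set_mem sw).
Qed.

End stopping.

Lemma martingaleD M N : martingale P Fil M -> martingale P Fil N ->
  martingale P Fil (fun t w => M t w + N t w).
Proof.
move=> /martingaleP[aM sM HM] /martingaleP[aN sN HN].
apply/martingaleP; split.
- apply/(adaptedP Fil_usual) => t t0; apply: fil_measurableD.
    exact: (proj1 (adaptedP Fil_usual M)).
  exact: (proj1 (adaptedP Fil_usual N)).
- by move=> t t0; apply: summableD; [exact: sM|exact: sN].
move=> s t s0 st A FA; have t0 := le_trans s0 st.
have mA := fil_sub Fil_usual s0 FA.
have E u : 0 <= u -> mean P (fun w => (M u w + N u w) * \1_A w) =
    mean P (fun w => M u w * \1_A w) + mean P (fun w => N u w * \1_A w).
  move=> u0; rewrite -meanD; [|exact/summableM1/sM|exact/summableM1/sN].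
  by apply: eq_mean => w; rewrite mulrDl.
by rewrite !E// (HM s t)// (HN s t).
Qed.

Lemma stopping_min sigma tau : stopping_time Fil sigma -> stopping_time Fil tau ->
  stopping_time Fil (fun w => Order.min (sigma w) (tau w)).
Proof.
move=> [s0 S] [t0 S']; split; first by move=> w; rewrite le_min s0 t0.
move=> t tge0; rewrite (_ : [set _ | _] =
    [set w | (sigma w <= t%:E)%E] `|` [set w | (tau w <= t%:E)%E]).
  by apply: (filU Fil_usual) => //; [exact: S|exact: S'].
apply/seteqP; split=> w /=; first by rewrite ge_min => /orP.
by rewrite ge_min => h; apply/orP.
Qed.

Lemma stopped_fineE sigma t w : 0 <= t -> stopping_time Fil sigma ->
  (fine (Order.min t%:E (sigma w)))%:E = Order.min t%:E (sigma w).
Proof.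
move=> t0 [s0 _]; rewrite fineK// minElt; case: ifPn => //; rewrite -leNgt => h.
rewrite fin_numElt (le_lt_trans h (ltry t)) andbT.
exact: lt_le_trans (ltNyr 0) (s0 w).
Qed.

Lemma stopped_stopped M sigma tau t w : 0 <= t ->
  stopping_time Fil sigma -> stopping_time Fil tau ->
  stopped (stopped M tau) sigma t w =
  stopped M (fun w => Order.min (tau w) (sigma w)) t w.
Proof.
move=> t0 Ss St; rewrite /stopped stopped_fineE//.
by rewrite -minA [Order.min (sigma w) _]minC.
Qed.

(** The stopped clock, the minimum of time and [sigma], is nondecreasing and 1-Lipschitz, so
    composing with it preserves continuity. *)
Lemma stopped_continuous M sigma : stopping_time Fil sigma ->
  continuous_paths M -> continuous_paths (stopped M sigma).
Proof.
move=> Ss Mc w; apply/within_continuousP => t; rewrite /= in_itv/= andbT => t0 e e0.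
pose r u := fine (Order.min u%:E (sigma w)).
have rE u : 0 <= u -> (r u)%:E = Order.min u%:E (sigma w).
  by move=> u0; exact: stopped_fineE.
have r0 u : 0 <= u -> 0 <= r u.
  by move=> u0; rewrite -lee_fin rE// le_min lee_fin u0 (proj1 Ss).
have r_nd u v : 0 <= u -> u <= v -> 0 <= r v - r u <= v - u.
  move=> u0 uv; have v0 := le_trans u0 uv.
  have h1 := rE u u0; have h2 := rE v v0.
  move: h1 h2; case: (sigma w) (proj1 Ss w) => [x| |] // x0 + +; last first.
    by rewrite !(min_idPl (leey _)) => -[->] [->]; lra.
  rewrite -!EFin_min => -[->] [->]; rewrite !minElt.
  by case: (ltP u x) => ?; case: (ltP v x) => ?; lra.
have /within_continuousP/(_ (r t)) := @Mc w.
rewrite /= in_itv/= andbT => /(_ (r0 _ t0) e e0)[dl dl0 dlP].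
exists dl => // u; rewrite /= in_itv/= andbT => u0 tu.
apply: dlP; first by rewrite /= in_itv/= andbT r0.
apply: le_lt_trans tu; rewrite -/(r t) -/(r u).
have [h|/ltW h] := leP t u.
  have := r_nd _ _ t0 h; rewrite (ler0_norm (x := t - u)) ?subr_le0//.
  by rewrite ler_norml; move: (r t) (r u) => a b; lra.
have := r_nd _ _ u0 h; rewrite (ger0_norm (x := t - u)) ?subr_ge0//.
by rewrite ler_norml; move: (r t) (r u) => a b; lra.
Qed.

Lemma eq_martingale M N : (forall t w, 0 <= t -> M t w = N t w) ->
  martingale P Fil M -> martingale P Fil N.
Proof.
move=> MN; have E t : 0 <= t -> M t = N t by move=> t0; apply/funext => w; exact: MN.
move=> [aM sM HM]; split.
- by move=> t t0; rewrite -E//; exact: aM.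
- by move=> t t0; rewrite -E//; exact: sM.
- by move=> s t s0 st; rewrite -!E ?(le_trans s0 st)//; exact: HM.
Qed.

(** The minimum of the two localizing sequences serves both summands, because a martingale stopped
    by its own sequence remains a martingale when stopped again by the other one. *)
Lemma continuous_local_martingale0D M N :
  continuous_local_martingale0 P Fil M -> continuous_local_martingale0 P Fil N ->
  continuous_local_martingale0 P Fil (fun t w => M t w + N t w).
Proof.
move=> [aM cM M0 [tau [St tau_nd tau_oo Mt]]] [aN cN N0 [sg [Ss sg_nd sg_oo Ns]]].
split.
- apply/(adaptedP Fil_usual) => t t0; apply: fil_measurableD.
    exact: (proj1 (adaptedP Fil_usual M)).
  exact: (proj1 (adaptedP Fil_usual N)).
- by move=> w; exact: within_continuousD.
- by move=> w; rewrite M0 N0 addr0.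
exists (fun n w => Order.min (tau n w) (sg n w)); split.
- by move=> n; exact: stopping_min.
- by move=> n w; rewrite le_min !ge_min tau_nd sg_nd orbT.
- near=> w; have ct : tau ^~ w @ \oo --> +oo%E by near: w.
  have cs : sg ^~ w @ \oo --> +oo%E by near: w.
  apply/cvgeyPge => A; near=> n; rewrite le_min; apply/andP; split; near: n.
    by move/cvgeyPge : ct; apply.
  by move/cvgeyPge : cs; apply.
move=> n.
have h1 : martingale P Fil (stopped (stopped M (tau n)) (sg n)).
  by apply: stopped_martingale => //; exact: stopped_continuous.
have h2 : martingale P Fil (stopped (stopped N (sg n)) (tau n)).
  by apply: stopped_martingale => //; exact: stopped_continuous.
apply: eq_martingale (martingaleD h1 h2) => t w t0.
rewrite !stopped_stopped// /stopped; congr (_ + N (fine (Order.min _ _)) w).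
exact: minC.
Unshelve. all: by end_near. Qed.

End optional_stopping.

(** * Brackets and stochastic integrals *)

Section mesh.
Context {R : realType} {d : measure_display} {Omega : measurableType d}.
Variable P : probability Omega R.
Implicit Types (S : seq R -> Omega -> R) (I J : Omega -> R).

Lemma measurable_sum_nat n (f : nat -> Omega -> R) :
  (forall i, (i < n)%N -> measurable_fun setT (f i)) ->
  measurable_fun setT (fun w => \sum_(0 <= i < n) f i w).
Proof.
elim: n => [|n IH] H.
  rewrite (_ : (fun _ => _) = fun=> 0); first exact: measurable_cst.
  by apply/funext => w; rewrite big_nil.
rewrite (_ : (fun _ => _) = fun w => \sum_(0 <= i < n) f i w + f n w); last first.
  by apply/funext => w; rewrite big_nat_recr.
by apply: measurable_funD; [apply: IH => i /ltnW; exact: H|exact: H].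
Qed.

Lemma measurable_dist_ge I J (e : R) : measurable_fun setT I ->
  measurable_fun setT J -> measurable [set w | e <= `|I w - J w|].
Proof.
move=> mI mJ; have mD : measurable_fun setT (fun w => `|I w - J w|).
  by apply: measurableT_comp => //; exact: measurable_funB.
have := mD measurableT _ (measurable_itv `[e, +oo[); rewrite setTI.
by congr (measurable _); apply/seteqP; split=> w /=; rewrite in_itv/= andbT.
Qed.

(* Otherwise some sequence of partitions with mesh tending to 0 would contradict
   dominated convergence. *)
Lemma cvg_proba_mesh_pointwise (t : R) S I :
  (forall s, itv_partition 0 t s -> measurable_fun setT (S s)) ->
  measurable_fun setT I ->
  (forall w (e : R), 0 < e -> exists2 delta : R, 0 < delta &
     forall s, fine_partition 0 t delta s -> `|S s w - I w| < e) ->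
  cvg_proba_mesh P t S I.
Proof.
move=> mS mI SI e e0; apply: contrapT => N.
have /choice[s sP] : forall n : nat, exists s, fine_partition 0 t n.+1%:R^-1 s /\
    (e%:E <= P [set w | (e <= `|S s w - I w|)%R])%E.
  move=> n; apply: contrapT => N'; apply: N; exists n.+1%:R^-1.
    by rewrite invr_gt0 ltr0n.
  by move=> s F; rewrite ltNge; apply/negP => h; apply: N'; exists s.
pose B n := [set w | (e <= `|S (s n) w - I w|)%R].
have mB n : measurable (B n).
  by apply: measurable_dist_ge => //; apply: mS; exact: (proj1 (proj1 (sP n))).
have PB n : e <= mean P (\1_(B n)).
  rewrite -lee_fin -mean_EFin.
    by rewrite integral_indic// setIT; exact: (proj2 (sP n)).
  by apply: (@summable_bounded _ _ _ P 1) => // w;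
    rewrite indicE; case: (_ \in _); rewrite ?normr1// normr0.
have : mean P (\1_(B n)) @[n --> \oo] --> mean P (fun=> 0).
  apply: (@mean_dominated _ _ _ P _ _ (fun=> 1)) => //.
  - move=> w; have [dl dl0 dlP] := SI w e e0.
    apply: cvg_near_cst; exists (Num.bound dl^-1) => // n /= nN.
    rewrite indicE memNset//= => Bn; have : `|S (s n) w - I w| < e.
      apply: dlP; apply: fine_partition_le (proj1 (sP n)).
      rewrite -[leRHS]invrK lef_pV2 ?posrE ?invr_gt0 ?ltr0n//.
      rewrite (le_trans (ltW (archi_boundP _))) ?invr_ge0 ?(ltW dl0)//.
      by rewrite ler_nat (leq_trans nN).
    by move: Bn; rewrite /B/=; lra.
  - exact: summable_cst.
  - by move=> n w; rewrite indicE; case: (_ \in _); rewrite ?normr1// normr0.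
rewrite [X in _ --> X](_ : _ = 0); last by rewrite /mean Rintegral_cst// mul0r.
move=> /cvgrPdist_lt/(_ e e0)[n _ /(_ n (leqnn n))].
by rewrite sub0r normrN => /ltr_normlW; have := PB n; lra.
Qed.

Lemma cvg_proba_mesh_unique (t : R) S I J : 0 <= t ->
  (forall s, itv_partition 0 t s -> measurable_fun setT (S s)) ->
  measurable_fun setT I -> measurable_fun setT J ->
  cvg_proba_mesh P t S I -> cvg_proba_mesh P t S J ->
  {ae P, forall w, I w = J w}.
Proof.
move=> t0 mS mI mJ SI SJ.
(* [cvg_proba_mesh] uses one [e] both as distance and as probability; here the distance [c] is held
   fixed while the probability bound shrinks. *)
have small (c e : R) : 0 < e -> e <= c / 2 ->
    (P [set w | (c <= `|I w - J w|)%R] <= (2 * e)%:E)%E.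
  move=> e0 ec; have [d1 d10 h1] := SI e e0; have [d2 d20 h2] := SJ e e0.
  have dd : 0 < Num.min d1 d2 by rewrite lt_min d10.
  have [s F] := fine_partition_exists t0 dd.
  have F1 : fine_partition 0 t d1 s by apply: fine_partition_le F; rewrite ge_min lexx.
  have F2 : fine_partition 0 t d2 s by apply: fine_partition_le F; rewrite ge_min lexx orbT.
  have ms := mS s (proj1 F).
  have m1 : measurable [set w | (e <= `|S s w - I w|)%R] by exact: measurable_dist_ge.
  have m2 : measurable [set w | (e <= `|S s w - J w|)%R] by exact: measurable_dist_ge.
  apply: (@le_trans _ _ (P ([set w | (e <= `|S s w - I w|)%R] `|`
      [set w | (e <= `|S s w - J w|)%R]))).
    apply: le_measure; rewrite ?inE; [exact: measurable_dist_ge|exact: measurableU|].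
    move=> w /= h; have [h1'|h1'] := leP e `|S s w - I w|; [by left|right].
    have := ler_normB (S s w - J w) (S s w - I w).
    by rewrite (_ : S s w - J w - (S s w - I w) = I w - J w); [lra|ring].
  apply: (le_trans (measureU2 P m1 m2)).
  by rewrite mulrDl !mul1r EFinD leeD//; apply: ltW; [exact: h1|exact: h2].
have null (n : nat) : P [set w | (n.+1%:R^-1 <= `|I w - J w|)%R] = 0%E.
  apply/eqP; rewrite eq_le measure_ge0 andbT; apply/lee_addgt0Pr => e e0.
  have n0 : 0 < n.+1%:R^-1 :> R by rewrite invr_gt0 ltr0n.
  have m0 : 0 < Num.min (e / 2) (n.+1%:R^-1 / 2) by rewrite lt_min !divr_gt0.
  have m1 : Num.min (e / 2) (n.+1%:R^-1 / 2) <= n.+1%:R^-1 / 2 by rewrite ge_min lexx orbT.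
  apply: le_trans (small _ _ m0 m1) _.
  rewrite add0e lee_fin; have : Num.min (e / 2) (n.+1%:R^-1 / 2) <= e / 2.
    by rewrite ge_min lexx.
  lra.
apply: (@negligibleS _ _ _ P (\bigcup_n [set w | (n.+1%:R^-1 <= `|I w - J w|)%R])).
  move=> w /= /eqP IJ; have IJ0 : 0 < `|I w - J w| by rewrite normr_gt0 subr_eq0.
  exists (Num.bound `|I w - J w|^-1) => //=.
  rewrite -[leRHS]invrK lef_pV2 ?posrE ?invr_gt0 ?ltr0n//.
  rewrite (le_trans (ltW (archi_boundP _))) ?invr_ge0 ?(ltW IJ0)//.
  by rewrite ler_nat.
apply: negligible_bigcup => n; apply/negligibleP; last exact: null.
exact: measurable_dist_ge.
Qed.

End mesh.

Section pathwise_sums.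
Context {R : realType}.
Implicit Types (f g V : R -> R) (t : R).

(** A sum of squares is at most the largest increment, small by uniform continuity, times the total
    variation. *)
Lemma sum_squares_small f t (e : R) : 0 <= t -> {within `[0, t], continuous f} ->
  bounded_variation 0 t f -> 0 < e -> exists2 delta : R, 0 < delta &
  forall s, fine_partition 0 t delta s ->
    `|\sum_(0 <= i < size s) (f (ppt 0 t s i.+1) - f (ppt 0 t s i)) ^+ 2| < e.
Proof.
move=> t0 fc /(bounded_variation_dominated t0)[V H] e0.
have V0 : V 0 <= V t := dominates_le H (lexx 0) t0 (lexx t).
pose e' := e / (V t - V 0 + 1).
have e'0 : 0 < e' by rewrite divr_gt0//; lra.
have [dl dl0 dlP] := segment_unif_continuous fc e'0.
exists dl => // s F.
pose c i := f (ppt 0 t s i.+1) - f (ppt 0 t s i).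
apply: (@le_lt_trans _ _ (e' * (V t - V 0))).
  apply: (@rs_sum_le _ e' f V 0 t s c) => //; [exact: ltW|exact: (proj1 F)|].
  move=> i si; have [h1 h2 h3] := ppt_itv si (proj1 F).
  have h4 := proj2 F i si.
  by apply/ltW/dlP; rewrite ?ltr_norml; lra.
have ee : e = e' * (V t - V 0) + e' by rewrite /e'; field; lra.
lra.
Qed.

End pathwise_sums.

(** * Brackets under perturbations of finite variation *)

Section brackets.
Context {R : realType} {d : measure_display} {Omega : measurableType d}.
Variables (P : probability Omega R) (Fil : R -> set (set Omega)).
Hypothesis Fil_usual : usual_filtration P Fil.
Implicit Types (X Y M A C Q : R -> Omega -> R).

Lemma adapted_measurable X : adapted Fil X -> forall t, 0 <= t ->
  measurable_fun setT (X t).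
Proof.
move=> aX t t0; apply: (fil_measurable_measurable Fil_usual t0).
exact: (proj1 (adaptedP Fil_usual X)).
Qed.

Lemma adaptedD X Y : adapted Fil X -> adapted Fil Y ->
  adapted Fil (fun t w => X t w + Y t w).
Proof.
move=> /(adaptedP Fil_usual) aX /(adaptedP Fil_usual) aY.
by apply/(adaptedP Fil_usual) => t t0; apply: fil_measurableD; [exact: aX|exact: aY].
Qed.

Lemma adapted_cst (x : R -> R) : adapted Fil (fun t _ => x t).
Proof. by apply/(adaptedP Fil_usual) => t t0; exact: fil_measurable_cst. Qed.

Lemma adaptedZ k X : adapted Fil X -> adapted Fil (fun t w => k * X t w).
Proof.
move=> /(adaptedP Fil_usual) aX; apply/(adaptedP Fil_usual) => t t0.
by apply: fil_measurableM; [exact: fil_measurable_cst|exact: aX].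
Qed.

Lemma continuous_pathsP X : continuous_paths X <->
  forall w (T : R), {within `[0, T], continuous (X ^~ w)}.
Proof.
split=> H w.
  move=> T; apply: continuous_subspaceW (@H w) => u /=.
  by rewrite !in_itv/= andbT => /andP[].
apply/within_continuousP => t; rewrite /= in_itv/= andbT => t0 e e0.
have /within_continuousP/(_ t) := H w (t + 1).
rewrite /= in_itv/= t0 lerDl ler01 => /(_ isT e e0)[dl dl0 dlP].
exists (Num.min dl 1); first by rewrite lt_min dl0/=.
move=> u; rewrite /= in_itv/= andbT => u0; rewrite lt_min => /andP[h1 h2].
apply: dlP => //; rewrite /= in_itv/= u0/=.
by move: h2; rewrite ltr_norml; lra.
Qed.

Lemma continuous_pathsD X Y : continuous_paths X -> continuous_paths Y ->
  continuous_paths (fun t w => X t w + Y t w).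
Proof. by move=> cX cY w; exact: within_continuousD. Qed.

Lemma continuous_pathsZ k X : continuous_paths X ->
  continuous_paths (fun t w => k * X t w).
Proof.
move=> /continuous_pathsP cX; apply/continuous_pathsP => w T.
exact: (C0TZ (k := k) (cX w T)).
Qed.

Lemma bounded_variationZ k (t : R) (f : R -> R) : 0 <= t ->
  bounded_variation 0 t f -> bounded_variation 0 t (fun u => k * f u).
Proof.
move=> t0 [B BP]; exists (`|k| * B) => _ [s P' <-].
rewrite (_ : variation _ _ _ _ = `|k| * variation 0 t f s).
  by rewrite ler_wpM2l//; apply: BP; exists s.
rewrite /variation mulr_sumr; apply: eq_bigr => i _ /=.
by rewrite -mulrBr normrM.
Qed.

Lemma continuous_FV0D A C : continuous_FV0 Fil A -> continuous_FV0 Fil C ->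
  continuous_FV0 Fil (fun t w => A t w + C t w).
Proof.
move=> [aA cA A0 bA] [aC cC C0 bC]; split.
- exact: adaptedD.
- exact: continuous_pathsD.
- by move=> w; rewrite A0 C0 addr0.
move=> t w; rewrite le_eqVlt => /predU1P[<-|t0]; first exact: bounded_variationxx.
by apply: bounded_variationD => //; [apply: bA|apply: bC]; exact: ltW.
Qed.

Lemma continuous_FV0Z k A : continuous_FV0 Fil A ->
  continuous_FV0 Fil (fun t w => k * A t w).
Proof.
move=> [aA cA A0 bA]; split; [exact: adaptedZ|exact: continuous_pathsZ|..].
  by move=> w; rewrite A0 mulr0.
by move=> t w t0; apply: bounded_variationZ => //; exact: bA.
Qed.

Lemma bracket_regular X : [/\ adapted Fil (bracket P Fil X),
  continuous_paths (bracket P Fil X), forall w, bracket P Fil X 0 w = 0 &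
  forall s t w, 0 <= s -> s <= t -> bracket P Fil X s w <= bracket P Fil X t w].
Proof.
rewrite /bracket; case: xgetP => [Q _ [aQ cQ Q0 Qnd _]//|_]; split=> //.
  exact: (adapted_cst (fun=> 0)).
by move=> w; apply: continuous_subspaceT => ?; exact: cvg_cst.
Qed.

Lemma bracket_FV0 X : continuous_FV0 Fil (bracket P Fil X).
Proof.
have [aQ cQ Q0 Qnd] := bracket_regular X; split=> // t w t0.
apply: nondecreasing_bounded_variation => u v.
by rewrite !in_itv/= => /andP[u0 _] _ uv; exact: Qnd.
Qed.

Lemma cobracket_FV0 X Y : continuous_FV0 Fil (cobracket P Fil X Y).
Proof.
have := continuous_FV0Z 2^-1 (continuous_FV0D (continuous_FV0D
  (bracket_FV0 (fun u v => X u v + Y u v)) (continuous_FV0Z (-1) (bracket_FV0 X)))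
  (continuous_FV0Z (-1) (bracket_FV0 Y))).
by congr (continuous_FV0 _ _); apply/funext => t; apply/funext => w;
  rewrite /cobracket !mulN1r.
Qed.

Lemma decompositionD X M A C : decomposition P Fil X M A -> continuous_FV0 Fil C ->
  decomposition P Fil (fun t w => X t w + C t w) M (fun t w => A t w + C t w).
Proof.
move=> [cM cA XE] cC; split=> //; first exact: continuous_FV0D.
by move=> t w t0; rewrite XE// addrA.
Qed.

Lemma continuous_semimartingale0D X Y :
  continuous_semimartingale0 P Fil X -> continuous_semimartingale0 P Fil Y ->
  continuous_semimartingale0 P Fil (fun t w => X t w + Y t w).
Proof.
move=> [M [A [cM cA XE]]] [N [B [cN cB YE]]].
exists (fun t w => M t w + N t w), (fun t w => A t w + B t w); split.
- exact: (continuous_local_martingale0D Fil_usual).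
- exact: continuous_FV0D.
- by move=> t w t0; rewrite XE// YE//; ring.
Qed.

Lemma continuous_semimartingale0_FV X C : continuous_semimartingale0 P Fil X ->
  continuous_FV0 Fil C ->
  continuous_semimartingale0 P Fil (fun t w => X t w + C t w).
Proof.
move=> [M [A D]] cC; exists M, (fun t w => A t w + C t w); exact: decompositionD.
Qed.

Lemma is_bracketD_FV X C Q : continuous_FV0 Fil C ->
  is_bracket P Fil X Q -> is_bracket P Fil (fun t w => X t w + C t w) Q.
Proof.
move=> cC [aQ cQ Q0 Qnd [M [A [D H]]]]; split=> //.
by exists M, (fun t w => A t w + C t w); split=> //; exact: decompositionD.
Qed.

(* The two processes have the same quadratic variations, hence the same chosen
   version. *)
Lemma bracketD_FV X C : continuous_FV0 Fil C ->
  bracket P Fil (fun t w => X t w + C t w) = bracket P Fil X.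
Proof.
move=> cC; rewrite /bracket; congr (xget _ _); apply/seteqP; split=> Q h /=.
  have := is_bracketD_FV (continuous_FV0Z (-1) cC) h.
  by congr (is_bracket _ _ _ _); apply/funext => t; apply/funext => w; ring.
exact: is_bracketD_FV.
Qed.

Lemma local_martingale0 : continuous_local_martingale0 P Fil (fun _ _ => 0).
Proof.
split; first exact: (adapted_cst (fun=> 0)).
- by move=> w; apply: continuous_subspaceT => ?; exact: cvg_cst.
- by [].
exists (fun _ _ => +oo%E); split=> //.
- move=> _; split=> // t t0; rewrite (_ : [set _ | _] = set0).
    by rewrite -(filE Fil_usual t0); exact: measurable0.
  by apply/seteqP; split=> w //=; rewrite leye_eq.
- by apply: aeW => w; exact: cvg_cst.
move=> _; split.
- exact: (adapted_cst (fun=> 0)).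
- by move=> t t0; exact: integrable0.
- by move=> s t s0 st B FB; rewrite /stopped !integral0.
Qed.

Lemma FV_semimartingale0 A : continuous_FV0 Fil A ->
  continuous_semimartingale0 P Fil A.
Proof.
move=> cA; exists (fun _ _ => 0), A; split=> //; first exact: local_martingale0.
by move=> t w t0; rewrite add0r.
Qed.

(** The chosen bracket comes with a decomposition A = M + B in which [M] need not be 0 a priori. But
    M = A - B has finite variation, so its sums of squares tend to 0 path by path and Q T = 0 almost
    surely; monotonicity extends this to all times of [0, T] outside one null set. *)
Lemma bracket_FV (T : R) A : 0 <= T -> continuous_FV0 Fil A ->
  {ae P, forall w, forall s, 0 <= s <= T -> bracket P Fil A s w = 0}.
Proof.
move=> T0 cA; rewrite /bracket; case: xgetP => [Q _ [aQ cQ Q0 Qnd [M [B [D H]]]]|_];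
  last by apply: aeW.
have {D} [[aM cM M0 _] cB XE] := D.
have [_ cD _ bD] := continuous_FV0D cA (continuous_FV0Z (-1) cB).
have ms s : itv_partition 0 T s -> measurable_fun setT (sum_squares M T s).
  move=> P'; apply: measurable_sum_nat => i si.
  have [h1 h2 h3] := ppt_itv si P'; apply: measurable_funX.
  by apply: measurable_funB; apply: adapted_measurable => //; lra.
have QT : {ae P, forall w, Q T w = 0}.
  apply: (@cvg_proba_mesh_unique _ _ _ P T (sum_squares M T)) => //.
  - exact: adapted_measurable.
  - exact: H.
  apply: cvg_proba_mesh_pointwise => //.
  move=> w e e0.
  have [dl dl0 dlP] := sum_squares_small T0 (proj1 (continuous_pathsP _) cD w T) (bD T w T0) e0.
  exists dl => // s F; rewrite subr0; apply: le_lt_trans (dlP s F).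
  rewrite le_eqVlt; apply/orP; left; apply/eqP; congr (`| _ |).
  apply: eq_big_nat => i /andP[_ si]; have [h1 h2 h3] := ppt_itv si (proj1 F).
  rewrite !XE; [|lra|lra]; congr (_ ^+ 2); ring.
apply: filterS QT => w QT s /andP[s0 sT]; apply/eqP; rewrite eq_le.
by rewrite -{1}QT Qnd//= -(Q0 w) Qnd.
Qed.

End brackets.

(** * Paths of X - <X>/2 and integration against them *)

Section compensated_processes.
Context {R : realType} {d : measure_display} {Omega : measurableType d}.
Variables (P : probability Omega R) (Fil : R -> set (set Omega)).
Hypothesis Fil_usual : usual_filtration P Fil.
Implicit Types (X Y Z C : R -> Omega -> R).

Definition regular X := [/\ adapted Fil X, continuous_paths X & forall w, X 0 w = 0].

Lemma semimartingale_regular X : continuous_semimartingale0 P Fil X -> regular X.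
Proof.
move=> [M [A [[aM cM M0 _] [aA cA A0 _] XE]]].
split; last by move=> w; rewrite XE// M0 A0 addr0.
  have aS := adaptedD Fil_usual aM aA; move=> t t0.
  have -> : X t = fun w => M t w + A t w by apply/funext => w; rewrite XE.
  exact: aS.
have cS := continuous_pathsD cM cA; move=> w.
have /within_continuousP H := @cS w; apply/within_continuousP => x x0 e e0.
have [dl dl0 dlP] := H x x0 e e0; exists dl => // y y0 xy.
move: x0 y0; rewrite /= !in_itv/= !andbT => x0 y0.
by rewrite !XE//; apply: dlP => //; rewrite /= in_itv/= y0.
Qed.

Lemma compensated_regular X : regular X -> regular (compensated P Fil X).
Proof.
move=> [aX cX X0]; have [aQ cQ Q0 _] := bracket_FV0 Fil_usual X.
have E : compensated P Fil X = fun t w => X t w + - 2^-1 * bracket P Fil X t w.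
  by apply/funext => t; apply/funext => w; rewrite /compensated mulNr.
rewrite E; split.
- by apply: (adaptedD Fil_usual) => //; exact: (adaptedZ Fil_usual).
- by apply: continuous_pathsD => //; exact: continuous_pathsZ.
- by move=> w; rewrite X0 Q0 mulr0 addr0.
Qed.

Lemma regular_C00 X (T : R) w : regular X -> C00 T (X ^~ w).
Proof. by move=> [_ /continuous_pathsP cX X0]; split; [exact: cX|exact: X0]. Qed.

(* Integration by parts turns the Ito sums of a deterministic integrand of
   finite variation into Riemann-Stieltjes sums, path by path. *)
Lemma stoch_int_RS (T t : R) (K : R -> R) Z (I : Omega -> R) :
  0 <= t <= T -> regular Z -> (forall u, t <= u <= T -> K u = 0) ->
  (forall w, is_RS_int (Z ^~ w) K 0 T (I w)) ->
  {ae P, forall w, stoch_int P (fun s _ => K s) Z t w = - I w}.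
Proof.
move=> /andP[t0 tT] [aZ cZ Z0] K0 HI.
have pathwise w e : 0 < e -> exists2 dl : R, 0 < dl & forall s,
    fine_partition 0 t dl s -> `|ito_sum (fun s _ => K s) Z t s w - - I w| < e.
  move=> e0; have [dl dl0 dlP] := is_RS_int_lim (is_RS_intW tT K0 (HI w)) e0.
  exists dl => // s F; have := dlP _ _ F (right_tagged (proj1 F)).
  rewrite -[ito_sum _ _ _ _ _]/(rs_sum (fun i => K (ppt 0 t s i)) (Z ^~ w) 0 t s).
  (* Both boundary terms vanish: [K t = 0] at the right end and [Z 0 = 0] at the left end. *)
  rewrite (rs_sum_abel _ _ (proj1 F)) Z0 K0 ?lexx// mulr0 mul0r subrr sub0r.
  by rewrite -opprD normrN.
have ms s : itv_partition 0 t s -> measurable_fun setT (ito_sum (fun s _ => K s) Z t s).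
  move=> P'; apply: measurable_sum_nat => i si.
  have [h1 h2 h3] := ppt_itv si P'; apply: measurable_funM => //.
  by apply: measurable_funB; apply: (adapted_measurable Fil_usual aZ); lra.
(* [I] is given path by path; its measurability comes from being a limit of Ito sums along one
   sequence of partitions common to all sample points. *)
have mI : measurable_fun setT (fun w => - I w).
  have /choice[s sP] : forall n : nat, exists s, fine_partition 0 t n.+1%:R^-1 s.
    by move=> n; apply: fine_partition_exists => //; rewrite invr_gt0 ltr0n.
  apply: (@measurable_fun_cvg _ _ _ setT (fun n => ito_sum (fun s _ => K s) Z t (s n))).
    by move=> n; apply: ms; exact: (proj1 (sP n)).
  move=> w _; apply/cvgrPdist_lt => e e0; have [dl dl0 dlP] := pathwise w e e0.
  exists (Num.bound dl^-1) => // n /= nN; rewrite distrC; apply: dlP.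
  apply: fine_partition_le (sP n).
  rewrite -[leRHS]invrK lef_pV2 ?posrE ?invr_gt0 ?ltr0n//.
  rewrite (le_trans (ltW (archi_boundP _))) ?invr_ge0 ?(ltW dl0)//.
  by rewrite ler_nat (leq_trans nN).
have cI : cvg_proba_mesh P t (ito_sum (fun s _ => K s) Z t) (fun w => - I w).
  exact: cvg_proba_mesh_pointwise.
have [mJ cJ] : [set J : Omega -> R | measurable_fun setT J /\
    cvg_proba_mesh P t (ito_sum (fun s _ => K s) Z t) J]
    (stoch_int P (fun s _ => K s) Z t).
  by apply: xgetPex; exists (fun w => - I w).
exact: cvg_proba_mesh_unique cJ cI.
Qed.

(** [bracketD_FV] identifies the chosen version for X + Y + <X, Y> with the one for X + Y, and
    polarization cancels the rest, so no null set appears. *)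
Lemma compensatedD X Y :
  compensated P Fil (fun u v => X u v + Y u v + cobracket P Fil X Y u v) =
  fun t w => compensated P Fil X t w + compensated P Fil Y t w.
Proof.
apply/funext => t; apply/funext => w; rewrite /compensated.
rewrite (bracketD_FV Fil_usual (fun u v => X u v + Y u v))//; last exact: cobracket_FV0.
rewrite /cobracket; set b := bracket _ _ _ t w; set b1 := bracket _ _ X t w.
by set b2 := bracket _ _ Y t w; field.
Qed.

Lemma ae_exists (Q : Omega -> Prop) : {ae P, forall w, Q w} -> exists w, Q w.
Proof.
move=> H; apply: contrapT => N.
have negl : P.-negligible setT.
  by apply: negligibleS H => w _ /= Qw; apply: N; exists w.
have := probability_setT P; rewrite (measure_negligible measurableT negl) => /esym/eqP.
by rewrite onee_eq0.
Qed.

End compensated_processes.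

(** * Functionals in the class C *)

Section additive_functionals.
Context {R : realType}.
Variable T : R.
Hypothesis T_gt0 : 0 < T.
Implicit Types (x y : R -> R).

(** The conditions concern all of [0, +oo[ and not [0, T], since such a path is to be a
    deterministic process, and processes run over all nonnegative times. *)
Definition FV_path : set (R -> R) :=
  [set x : R -> R | [/\ forall b, {within `[0, b], continuous x}, x 0 = 0 &
    forall t, 0 <= t -> bounded_variation 0 t x]].

Lemma FV_pathD x y : FV_path x -> FV_path y -> FV_path (fun u => x u + y u).
Proof.
move=> [cx x0 bx] [cy y0 bY]; split.
- by move=> b; exact: C0TD.
- by rewrite x0 y0 addr0.
move=> t; rewrite le_eqVlt => /predU1P[<-|t0]; first exact: bounded_variationxx.
by apply: bounded_variationD => //; [apply: bx|apply: bY]; exact: ltW.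
Qed.

Lemma FV_pathZ k x : FV_path x -> FV_path (fun u => k * x u).
Proof.
move=> [cx x0 bx]; split.
- by move=> b; exact: C0TZ.
- by rewrite x0 mulr0.
by move=> t t0; apply: bounded_variationZ => //; exact: bx.
Qed.

Lemma FV_path_ramp s k : 0 <= k -> 0 <= s -> FV_path (ramp s k).
Proof.
move=> k0 s0; split; first by move=> b; exact: C0T_ramp.
  exact: ramp0.
move=> t t0; apply: nondecreasing_bounded_variation => u v _ _.
exact: ramp_nd.
Qed.

Lemma FV_path_sum n (f : nat -> R -> R) : (forall i, (i < n)%N -> FV_path (f i)) ->
  FV_path (fun u => \sum_(0 <= i < n) f i u).
Proof.
elim: n => [|n IH] H.
  rewrite (_ : (fun _ => _) = fun u => 0 * ramp 0 0 u).
    by apply: FV_pathZ; exact: FV_path_ramp.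
  by apply/funext => u; rewrite big_nil mul0r.
rewrite (_ : (fun _ => _) = fun u => \sum_(0 <= i < n) f i u + f n u); last first.
  by apply/funext => u; rewrite big_nat_recr.
by apply: FV_pathD; [apply: IH => i /ltnW; exact: H|exact: H].
Qed.

(** Ramps are monotone, so the finite combinations produced by [ramp_approx] have finite
    variation. *)
Lemma FV_path_dense x (e : R) : C00 T x -> 0 < e ->
  exists2 y, FV_path y & forall u, 0 <= u <= T -> `|x u - y u| <= e.
Proof.
move=> cx e0; have [dl dl0 dlP] := ramp_approx cx e0.
have [s F] := fine_partition_exists (ltW T_gt0) dl0.
have := dlP s _ _ F (left_tagged (proj1 F)) (lexx _).
have k0 : 0 <= dl^-1 by rewrite invr_ge0 ltW.
move=> H; exists (fun u => \sum_(0 <= i < size s) x (ppt 0 T s i) *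
  (ramp (ppt 0 T s i) dl^-1 u - ramp (ppt 0 T s i.+1) dl^-1 u)) => //.
apply: FV_path_sum => i si; have [h1 h2 h3] := ppt_itv si (proj1 F).
have [p0 p1] : 0 <= ppt 0 T s i /\ 0 <= ppt 0 T s i.+1 by split; lra.
apply: FV_pathZ; rewrite (_ : (fun _ => _) = fun u =>
    ramp (ppt 0 T s i) dl^-1 u + -1 * ramp (ppt 0 T s i.+1) dl^-1 u); last first.
  by apply/funext => u; rewrite mulN1r.
by apply: FV_pathD; [|apply: FV_pathZ]; exact: FV_path_ramp.
Qed.

Lemma FV_path_C00 x : FV_path x -> C00 T x.
Proof. by move=> [cx x0 _]; split=> //; exact: cx. Qed.

Variable L : (R -> R) -> R.
Hypothesis L_cont : forall x, C00 T x -> forall e : R, 0 < e ->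
  exists2 d : R, 0 < d & forall y, C00 T y ->
    (forall u, 0 <= u <= T -> `|x u - y u| < d) -> `|L x - L y| < e.
Hypothesis L_FV : forall x y, FV_path x -> FV_path y ->
  L (fun u => x u + y u) = L x + L y.

Lemma additive_functional x y : C00 T x -> C00 T y ->
  L (fun u => x u + y u) = L x + L y.
Proof.
move=> cx cy; apply/eqP; rewrite -subr_eq0 -normr_le0; apply/ler_addgt0Pr => e e0.
rewrite add0r; have e3 : 0 < e / 3 by lra.
have [d1 d10 h1] := L_cont cx e3; have [d2 d20 h2] := L_cont cy e3.
have [d3 d30 h3] := L_cont (C00D cx cy) e3.
pose dl := Num.min d1 (Num.min d2 d3).
have dl0 : 0 < dl by rewrite !lt_min d10 d20.
have dl2 : 0 < dl / 3 by lra.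
have [l1 l2 l3] : [/\ dl <= d1, dl <= d2 & dl <= d3].
  by rewrite /dl !ge_min !lexx !orbT.
clearbody dl; have [x' fx xx'] := FV_path_dense cx dl2; have [y' fy yy'] := FV_path_dense cy dl2.
have g1 : `|L x - L x'| < e / 3.
  by apply: h1 => [|u /xx' h]; [exact: FV_path_C00|lra].
have g2 : `|L y - L y'| < e / 3.
  by apply: h2 => [|u /yy' h]; [exact: FV_path_C00|lra].
have g3 : `|L (fun u => x u + y u) - L (fun u => x' u + y' u)| < e / 3.
  apply: h3 => [|u uT]; first exact/FV_path_C00/FV_pathD.
  have := ler_normD (x u - x' u) (y u - y' u); have := xx' u uT; have := yy' u uT.
  by rewrite addrACA -opprD; lra.
rewrite (L_FV fx fy) in g3.
by move: g1 g2 g3; rewrite !ltr_norml ler_norml; lra.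
Qed.

Let L0 : L (fun=> 0) = 0.
Proof.
have := additive_functional (C00_0 T) (C00_0 T); rewrite (_ : (fun _ => _) = fun=> 0).
  lra.
by apply/funext => u; rewrite addr0.
Qed.

Let LMn n x : C00 T x -> L (fun u => n%:R * x u) = n%:R * L x.
Proof.
move=> cx; elim: n => [|n IH].
  by rewrite mul0r -[RHS]L0; congr L; apply/funext => u; rewrite mul0r.
rewrite -natr1 [RHS]mulrDl mul1r -IH -additive_functional//; last exact: C00Z.
by congr L; apply/funext => u; rewrite mulrDl mul1r.
Qed.

Let LN x : C00 T x -> L (fun u => - x u) = - L x.
Proof.
move=> cx; have cN : C00 T (fun u => - x u).
  by have := C00Z (-1) cx; congr (C00 _ _); apply/funext => u; rewrite mulN1r.
apply/eqP; rewrite -subr_eq0 opprK -additive_functional// -L0; apply/eqP.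
by congr L; apply/funext => u; rewrite addNr.
Qed.

(* The additive function [L (c x) - c L x] of [c] vanishes at 1 and is bounded on
   [0, 1]. *)
Lemma homogeneous_functional k x : C00 T x -> L (fun u => k * x u) = k * L x.
Proof.
move=> cx; wlog k0 : k / 0 <= k.
  move=> W; have [|/ltW k0] := leP 0 k; first exact: W.
  have := W (- k); rewrite oppr_ge0 => /(_ k0); rewrite mulNr => h.
  rewrite -[LHS]opprK -[RHS]opprK -h -LN; last exact: C00Z.
  by congr (- L _); apply/funext => u; rewrite mulNr.
have [M M0 xM] := segment_continuous_bounded (proj1 cx).
have [dl dl0 dlP] := L_cont (C00_0 T) ltr01.
(* [N] is so large that x / N lies within [dl] of 0, where [L] is below 1 in absolute value;
   additivity restores the factor [N]. *)
pose N := (Num.bound (M / dl)).+1.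
have N0 : 0 < N%:R :> R by rewrite ltr0n.
have small c : 0 <= c <= 1 -> `|L (fun u => c * x u)| <= N%:R.
  move=> /andP[c0 c1]; pose y u := c / N%:R * x u.
  have cy : C00 T y by exact: C00Z.
  have -> : (fun u => c * x u) = fun u => N%:R * y u.
    by apply/funext => u; rewrite /y mulrA mulrCA divff ?mulr1// gt_eqF.
  rewrite LMn// normrM (ger0_norm (ltW N0)) -[leRHS]mulr1 ler_wpM2l ?(ltW N0)//.
  have := dlP y cy; rewrite L0 sub0r normrN => h; apply/ltW/h => u uT.
  rewrite sub0r normrN /y !normrM (ger0_norm c0) ger0_norm ?invr_ge0 ?(ltW N0)//.
  have h1 : M / dl < N%:R.
    by rewrite (lt_trans (archi_boundP _))// ?ltr_nat// divr_ge0// ltW.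
  rewrite ltr_pdivrMr// in h1.
  rewrite mulrAC ltr_pdivrMr// [ltRHS]mulrC; apply: le_lt_trans h1.
  by rewrite -[leRHS]mul1r ler_pM// xM.
pose f c := L (fun u => c * x u) - c * L x.
have fB c : 0 <= c <= 1 -> `|f c| <= N%:R + `|L x|.
  move=> c01; rewrite /f (le_trans (ler_normB _ _))// lerD ?small// normrM.
  by move: c01 => /andP[c0 c1]; rewrite (ger0_norm c0) -[leRHS]mul1r ler_wpM2r.
(* With [m] the integer part of n k, additivity gives n f(k) = f(n k - m), whose argument lies in
   [0, 1]. So all multiples of [f k] obey one bound, which forces f k = 0. *)
have fk n : n%:R * `|f k| <= N%:R + `|L x|.
  have nk0 : 0 <= n%:R * k by rewrite mulr_ge0.
  have /andP[m1 m2] := truncn_itv nk0; set m := Num.truncn (n%:R * k) in m1 m2.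
  suff -> : n%:R * `|f k| = `|f (n%:R * k - m%:R)|.
    by apply: fB; rewrite -natr1 in m2; lra.
  rewrite -[X in X * _](ger0_norm (ler0n R n)) -normrM; congr `| _ |.
  rewrite /f mulrBr -LMn; last exact: C00Z.
  rewrite (_ : (fun u => (n%:R * k - m%:R) * x u) =
    fun u => n%:R * (k * x u) + - (m%:R * x u)); last first.
    by apply/funext => u; ring.
  rewrite additive_functional; [|exact/C00Z/C00Z|]; last first.
    have := C00Z (- m%:R) cx; congr (C00 _ _); apply/funext => u.
    by rewrite mulNr.
  rewrite LN ?LMn//; [ring|exact: C00Z|exact: C00Z].
apply/eqP; rewrite -subr_eq0; apply/eqP/normr0_eq0; rewrite -/(f k).
apply/eqP; rewrite eq_le normr_ge0 andbT leNgt; apply/negP => f0.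
pose A := N%:R + `|L x|.
have A0 : 0 <= A by rewrite addr_ge0.
have := fk (Num.bound (A / `|f k|)); rewrite -ler_pdivlMr// leNgt => /negP; apply.
by rewrite archi_boundP// divr_ge0// ltW.
Qed.

Lemma bounded_functional : exists B, forall x M, C00 T x ->
  (forall u, 0 <= u <= T -> `|x u| <= M) -> `|L x| <= B * M.
Proof.
have [dl dl0 dlP] := L_cont (C00_0 T) ltr01.
exists (2 / dl) => x M cx xM.
have B0 : 0 < 2 / dl by rewrite divr_gt0.
have M0 : 0 <= M by apply: le_trans (xM 0 _); rewrite // lexx ltW.
(* [M] may be 0, so the rescaling uses a strictly larger [M'], which then decreases to [M]. *)
have key M' : M < M' -> `|L x| <= 2 / dl * M'.
  move=> MM'; have M'0 : 0 < M' by lra.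
  pose y u := dl / (2 * M') * x u.
  have q0 : 0 < dl / (2 * M') by rewrite divr_gt0// mulr_gt0.
  have cy : C00 T y by exact: C00Z.
  have := dlP y cy; rewrite L0 sub0r normrN homogeneous_functional// => h.
  have {}h : `|dl / (2 * M') * L x| < 1.
    apply: h => u uT; rewrite sub0r normrN normrM (gtr0_norm q0).
    apply: (@le_lt_trans _ _ (dl / (2 * M') * M')).
      by rewrite ler_wpM2l ?(ltW q0)// (le_trans (xM u uT))// ltW.
    have -> : dl / (2 * M') * M' = dl / 2 by field; lra.
    lra.
  rewrite normrM (gtr0_norm q0) in h.
  have -> : 2 / dl * M' = (dl / (2 * M'))^-1 by field; lra.
  by rewrite -[leRHS]mulr1 ler_pdivlMl// ltW.
apply/ler_addgt0Pr => e e0; apply: le_trans (key (M + e / (2 / dl)) _) _.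
  by rewrite ltrDl divr_gt0.
by rewrite mulrDr mulrCA divff ?mulr1// gt_eqF.
Qed.

End additive_functionals.

(** * From the functional to the kernel and back *)

Section characterization.
Context {R : realType} {d : measure_display} {Omega : measurableType d}.
Variables (P : probability Omega R) (Fil : R -> set (set Omega)).
Hypothesis Fil_usual : usual_filtration P Fil.
Variable T : R.
Hypothesis T_gt0 : 0 < T.
Variable F : R -> (R -> Omega -> R) -> Omega -> R.

Lemma is_RS_int_cst (k a b : R) (g : R -> R) :
  is_RS_int (fun=> k) g a b (k * (g b - g a)).
Proof.
move=> e e0; exists 1 => // s z [P' _] _.
rewrite -mulr_sumr telescope_sumr// [ppt a b s (size s)](itv_partition_nth_size b P').
by rewrite /ppt/= subrr normr0.
Qed.

Lemma cst_C0T (x : R -> R) : C0T T x -> C00 T (fun u => x u - x 0).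
Proof.
move=> cx; split; last by rewrite subrr.
by apply: (C0TD (y := fun=> - x 0)) => //; exact: C0T_cst.
Qed.

Section kernel_of_functional.
Variable h : R -> (R -> R) -> R.
Hypothesis h_cont : continuous_path_functional T h.
Hypothesis h_na : non_anticipative T h.
Hypothesis F_h : forall X, continuous_semimartingale0 P Fil X ->
  forall t, 0 <= t <= T ->
  {ae P, forall w, F t X w = expR (h t (fun s => compensated P Fil X s w))}.
Hypothesis F_eq : functional_equation P Fil T F.

Lemma FV_process x : FV_path x -> continuous_FV0 Fil (fun t (_ : Omega) => x t).
Proof.
move=> [cx x0 bx]; split=> //; first exact: (adapted_cst Fil_usual).
- by apply/continuous_pathsP => w b; exact: cx.
- by move=> t _ t0; exact: bx.
Qed.

(* The bracket of a deterministic process vanishes only almost surely, so all the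
   equations are read at one well-chosen sample point. *)
Lemma functional_FV t x y : 0 <= t <= T -> FV_path x -> FV_path y ->
  h t (fun u => x u + y u) = h t x + h t y.
Proof.
move=> tT fx fy.
pose X u (_ : Omega) := x u; pose Y u (_ : Omega) := y u.
have FX : continuous_FV0 Fil X := FV_process fx.
have FY : continuous_FV0 Fil Y := FV_process fy.
have FXY : continuous_FV0 Fil (fun u v => X u v + Y u v) := continuous_FV0D Fil_usual FX FY.
have FC : continuous_FV0 Fil (cobracket P Fil X Y) := cobracket_FV0 Fil_usual X Y.
have FZ := continuous_FV0D Fil_usual FXY FC.
have sX := FV_semimartingale0 Fil_usual FX.
have sY := FV_semimartingale0 Fil_usual FY.
have sZ := FV_semimartingale0 Fil_usual FZ.
have BX := bracket_FV Fil_usual (ltW T_gt0) FX.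
have BY := bracket_FV Fil_usual (ltW T_gt0) FY.
have [w [[[[hX hY] [hZ hE]] [bX bY]]]] : exists w, ((((
    F t X w = expR (h t (fun s => compensated P Fil X s w)) /\
    F t Y w = expR (h t (fun s => compensated P Fil Y s w))) /\ (
    F t (fun u v => X u v + Y u v + cobracket P Fil X Y u v) w =
      expR (h t (fun s => compensated P Fil
        (fun u v => X u v + Y u v + cobracket P Fil X Y u v) s w)) /\
    F t X w * F t Y w = F t (fun u v => X u v + Y u v + cobracket P Fil X Y u v) w)) /\
    ((forall s, 0 <= s <= T -> bracket P Fil X s w = 0) /\
     (forall s, 0 <= s <= T -> bracket P Fil Y s w = 0))) /\ True).
  apply: (@ae_exists _ _ _ P).
  have hX := F_h sX tT; have hY := F_h sY tT; have hZ := F_h sZ tT.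
  have hE := F_eq sX sY tT.
  near=> w; do !split; near: w => //.
move=> _; apply: expR_inj; rewrite expRD.
have comp_path V : continuous_semimartingale0 P Fil V ->
    C0T T (fun s => compensated P Fil V s w).
  move=> sV; have rV := compensated_regular Fil_usual (semimartingale_regular Fil_usual sV).
  by case: (regular_C00 T w rV).
have C0Tx : C0T T x := proj1 (FV_path_C00 T fx).
have C0Ty : C0T T y := proj1 (FV_path_C00 T fy).
have sT s : 0 <= s <= t -> 0 <= s <= T by lra.
(* At this sample point the compensated path is known to equal [x] on [0, T] only, not on the whole
   line; non-anticipation bridges the difference. *)
have eX : h t (fun s => compensated P Fil X s w) = h t x.
  apply: h_na => //; first exact: comp_path.
  by move=> s /sT st; rewrite /compensated bX// mulr0 subr0.
have eY : h t (fun s => compensated P Fil Y s w) = h t y.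
  apply: h_na => //; first exact: comp_path.
  by move=> s /sT st; rewrite /compensated bY// mulr0 subr0.
have eZ : h t (fun s => compensated P Fil
    (fun u v => X u v + Y u v + cobracket P Fil X Y u v) s w) = h t (fun u => x u + y u).
  apply: h_na => //; [exact: comp_path|exact: C0TD|].
  move=> s /sT st; rewrite (compensatedD Fil_usual).
  by rewrite /compensated bX// bY// mulr0 !subr0.
by rewrite -eX -eY -eZ -hX -hY -hZ hE.
Unshelve. all: by end_near. Qed.

Let h_cont_at t : 0 <= t <= T -> forall x, C00 T x -> forall e : R, 0 < e ->
  exists2 dl : R, 0 < dl & forall y, C00 T y ->
    (forall u, 0 <= u <= T -> `|x u - y u| < dl) -> `|h t x - h t y| < e.
Proof.
move=> tT x [cx _] e e0.
have [dl dl0 dlP] := proj1 (continuous_path_functionalP T h) h_cont t x tT cx e e0.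
by exists dl => // y [cy _] xy; apply: dlP => //; rewrite subrr normr0.
Qed.

Let h_add t : 0 <= t <= T -> forall x y, C00 T x -> C00 T y ->
  h t (fun u => x u + y u) = h t x + h t y.
Proof.
move=> tT x y; apply: (additive_functional T_gt0 (h_cont_at tT)).
by move=> x' y'; exact: functional_FV.
Qed.

Let h_scale t : 0 <= t <= T -> forall k x, C00 T x ->
  h t (fun u => k * x u) = k * h t x.
Proof.
move=> tT k x; apply: (homogeneous_functional T_gt0 (h_cont_at tT)).
by move=> x' y'; exact: functional_FV.
Qed.

Let h_bnd t : 0 <= t <= T -> exists B, forall x M, C00 T x ->
  (forall u, 0 <= u <= T -> `|x u| <= M) -> `|h t x| <= B * M.
Proof.
move=> tT; apply: (bounded_functional T_gt0 (h_cont_at tT)).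
by move=> x' y'; exact: functional_FV.
Qed.

(** [admissible_kernel] asks K t s = 0 for s >= t also when t > T, where nothing is known about
    [h t]; the default 0 takes care of it. *)
Definition functional_kernel (t s : R) : R :=
  if 0 <= t <= T then riesz_kernel (h t) s else 0.

Local Notation K := functional_kernel.

Let KE t : 0 <= t <= T -> K t = riesz_kernel (h t).
Proof. by move=> tT; apply/funext => s; rewrite /K tT. Qed.

(** A ramp starting at s >= t agrees with the zero path up to time [t], so [h t] vanishes on it by
    non-anticipation, and so does the limit. *)
Let K0 t s : 0 <= t -> t <= s -> K t s = 0.
Proof.
move=> t0 ts; rewrite /K; case: ifP => // tT.
have h0 : h t (fun=> 0) = 0.
  have E := h_scale tT 0 (C00_0 T); rewrite [RHS]mul0r in E.
  by rewrite -[RHS]E; congr (h t _); apply/funext => u; rewrite mul0r.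
apply/cvg_lim => //; rewrite (_ : (fun n => _) = fun=> 0); first exact: cvg_cst.
apply/funext => n; rewrite -[RHS]h0; apply: h_na => //.
- exact: C0T_ramp.
- exact: C0T_cst.
- by move=> u ut; apply: ramp0 => //; lra.
Qed.

Let K_RS t x : 0 <= t <= T -> C00 T x -> is_RS_int x (K t) 0 T (- h t x).
Proof.
move=> tT cx; rewrite KE//; have [B HB] := h_bnd tT.
exact: (riesz_representation (h_add tT) (h_scale tT) HB).
Qed.

(** The constant [x 0] contributes x 0 (K t T - K t 0) over ]0, T]. The atom cancels the second term
    and K t T = 0, so only the path x - x 0 is seen. *)
Let K_stieltjes t x : 0 <= t <= T -> C0T T x ->
  stieltjes_int T x (K t) = - h t (fun u => x u - x 0).
Proof.
move=> tT cx; rewrite /stieltjes_int.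
have := is_RS_intD (K_RS tT (cst_C0T cx)) (@is_RS_int_cst (x 0) 0 T (K t)).
rewrite (_ : (fun u => x u - x 0 + x 0) = x); last first.
  by apply/funext => u; rewrite subrK.
move=> /(is_RS_intE (ltW T_gt0)) ->.
by rewrite (@K0 t T); [ring|lra|lra].
Qed.

Lemma functional_kernel_admissible : admissible_kernel T K.
Proof.
split; first exact: K0.
  move=> t tT; have [B HB] := h_bnd tT; rewrite KE//.
  have bv b := riesz_kernel_bounded_variation (h_add tT) (h_scale tT) HB b.
  split; last exact: bv.
  split=> s s0; first exact: riesz_kernel_right_continuous (h_add tT) (h_scale tT) HB _ s0.
  by apply: bounded_variation_left_limit s0 (bv s).
move=> x cx; apply/within_continuousP => t; rewrite /= in_itv/= => tT e e0.
have [cx0 _] := cst_C0T cx.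
have [dl dl0 dlP] := proj1 (continuous_path_functionalP T h) h_cont t _ tT cx0 e e0.
exists dl => // t'; rewrite /= in_itv/= => t'T tt'.
rewrite !K_stieltjes// -opprD normrN.
by apply: dlP => // u _; rewrite subrr normr0.
Qed.

Lemma functional_kernel_form : exp_integral_form P Fil T K F.
Proof.
move=> X sX t tT; have rX := semimartingale_regular Fil_usual sX.
have rC := compensated_regular Fil_usual rX.
have HI w : is_RS_int (fun s => compensated P Fil X s w) (K t) 0 T
    (- h t (fun s => compensated P Fil X s w)).
  apply: (K_RS tT). exact: (regular_C00 T w rC).
have Kt0 u : t <= u <= T -> K t u = 0 by move=> tu; apply: K0; lra.
have := stoch_int_RS Fil_usual tT rC Kt0 HI; have := F_h sX tT.
by apply: filterS2 => w -> ->; rewrite opprK.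
Qed.

End kernel_of_functional.

Section functional_of_kernel.
Variable K : R -> R -> R.
Hypothesis K_admissible : admissible_kernel T K.
Hypothesis F_K : exp_integral_form P Fil T K F.

(** On paths vanishing at 0 this is the integral of [K t] against [x] after integration by parts.
    With the atom included for other paths, condition ii) on the kernel is exactly continuity of [h]
    in time at each fixed path. *)
Let h (t : R) (x : R -> R) : R := - stieltjes_int T x (K t).

Let K_RS t x : 0 <= t <= T -> C0T T x -> is_RS_int x (K t) 0 T (RS_int x (K t) 0 T).
Proof.
move=> tT cx; have [_ /(_ t tT)[_ bv] _] := K_admissible.
have [I HI] := is_RS_int_exists (ltW T_gt0) bv cx.
by rewrite (is_RS_intE (ltW T_gt0) HI).
Qed.

Let hD t : 0 <= t <= T -> forall x y, C0T T x -> C0T T y ->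
  h t (fun u => x u + y u) = h t x + h t y.
Proof.
move=> tT x y cx cy; rewrite /h /stieltjes_int.
rewrite (is_RS_intE (ltW T_gt0) (is_RS_intD (K_RS tT cx) (K_RS tT cy))).
by ring.
Qed.

Let hZ t : 0 <= t <= T -> forall k x, C0T T x ->
  h t (fun u => k * x u) = k * h t x.
Proof.
move=> tT k x cx; rewrite /h /stieltjes_int.
rewrite (is_RS_intE (ltW T_gt0) (is_RS_intZ k (K_RS tT cx))).
by ring.
Qed.

Let h_bounded t : [set t | 0 <= t <= T] t -> exists B, bounded_by T h t B.
Proof.
move=> /= tT; have [_ /(_ t tT)[_ bv] _] := K_admissible.
have [V HV] := bounded_variation_dominated (ltW T_gt0) bv.
exists (`|K t 0| + (V T - V 0)) => x M cx M0 xM.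
rewrite /h normrN /stieltjes_int (le_trans (ler_normD _ _))// mulrDl lerD//.
  by rewrite normrM mulrC ler_wpM2l// xM// lexx ltW.
rewrite [leRHS]mulrC.
exact: (is_RS_int_le (ltW T_gt0) (ltW M0) HV xM (K_RS tT cx)).
Qed.

(** The difference is split at [h t' x]: condition ii) controls the change of time, and a Lipschitz
    bound in the path, uniform in [t'], the rest. The pointwise bounds fed to [uniform_boundedness]
    come from continuity on the compact [0, T]. *)
Lemma kernel_functional_continuous : continuous_path_functional T h.
Proof.
have [_ _ Kc] := K_admissible.
have pw x : C0T T x -> exists A, forall t, [set t | 0 <= t <= T] t -> `|h t x| <= A.
  move=> cx; have [M M0 MP] := segment_continuous_bounded (Kc x cx).
  by exists M => t tT; rewrite /h normrN; exact: MP.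
have [B HB] := uniform_boundedness hD hZ h_bounded pw.
apply/continuous_path_functionalP => t x tT cx e e0.
have /within_continuousP/(_ t) := Kc x cx.
rewrite /= in_itv/= => /(_ tT (e / 2))[|d1 d10 dP1]; first lra.
pose B' := `|B| + 1; have B'0 : 0 < B' by rewrite ltr_wpDl.
have d20 : 0 < e / 2 / B' by rewrite !divr_gt0.
exists (Num.min d1 (e / 2 / B')); first by rewrite lt_min d10.
move=> t' y t'T cy; rewrite lt_min => /andP[tt' _] xy.
have h1 : `|h t x - h t' x| < e / 2.
  by rewrite /h -opprD normrN; apply: dP1.
have cxy : C0T T (fun u => x u + -1 * y u) by apply: C0TD => //; exact: C0TZ.
have h2 : `|h t' x - h t' y| <= e / 2.
  have := HB t' t'T _ _ cxy d20; rewrite hD ?hZ//; last exact: C0TZ.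
  rewrite mulN1r => /(_ _)/le_trans; apply.
    move=> u uT; rewrite mulN1r; apply: ltW; apply: lt_le_trans (xy u uT) _.
    by rewrite ge_min lexx orbT.
  have BB' : B <= B' by rewrite /B'; have := ler_norm B; lra.
  apply: (@le_trans _ _ (B' * (e / 2 / B'))); first by rewrite ler_wpM2r// ltW.
  by rewrite mulrCA divff ?mulr1// gt_eqF.
have -> : h t x - h t' y = (h t x - h t' x) + (h t' x - h t' y) by ring.
by rewrite (le_lt_trans (ler_normD _ _))//; lra.
Qed.

Lemma kernel_functional_non_anticipative : non_anticipative T h.
Proof.
move=> x y t cx cy tT xy; have [K0 _ _] := K_admissible.
rewrite /h /stieltjes_int (xy 0); last lra.
congr (- (_ + _)).
apply: (@is_RS_int_local _ 0 t T x y (K t)) (K_RS tT cx) (K_RS tT cy) => //; try lra.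
by move=> u tu; apply: K0; lra.
Qed.

Let F_h X : continuous_semimartingale0 P Fil X -> forall t, 0 <= t <= T ->
  {ae P, forall w, F t X w = expR (h t (fun s => compensated P Fil X s w))}.
Proof.
move=> sX t tT; have [K0 _ _] := K_admissible.
have rX := semimartingale_regular Fil_usual sX.
have rC := compensated_regular Fil_usual rX.
have cC w : C00 T (fun s => compensated P Fil X s w) := regular_C00 T w rC.
have Kt0 u : t <= u <= T -> K t u = 0 by move=> tu; apply: K0; lra.
have := stoch_int_RS Fil_usual tT rC Kt0 (fun w => K_RS tT (proj1 (cC w))).
have := F_K sX tT; apply: filterS2 => w -> ->.
by rewrite /h /stieltjes_int (proj2 (cC w)) mul0r add0r.
Qed.

Lemma kernel_class_C : class_C P Fil T F.
Proof.
exists h; split.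
- exact: kernel_functional_continuous.
- exact: kernel_functional_non_anticipative.
- exact: F_h.
Qed.

Lemma kernel_functional_equation : functional_equation P Fil T F.
Proof.
move=> X Y sX sY t tT.
have sZ := continuous_semimartingale0_FV Fil_usual
  (continuous_semimartingale0D Fil_usual sX sY) (cobracket_FV0 Fil_usual X Y).
have := F_h sZ tT; have := F_h sY tT; have := F_h sX tT.
apply: filterS3 => w -> -> ->.
have c V : continuous_semimartingale0 P Fil V ->
    C0T T (fun s => compensated P Fil V s w).
  move=> sV; have rV := compensated_regular Fil_usual (semimartingale_regular Fil_usual sV).
  by case: (regular_C00 T w rV).
by rewrite (compensatedD Fil_usual) hD ?expRD//; exact: c.
Qed.

End functional_of_kernel.

End characterization.

Unset Implicit Arguments.

Theorem theorem3 (R : realType) (d : measure_display) (Omega : measurableType d)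
    (P : probability Omega R) (Fil : R -> set (set Omega))
    (P_complete : measure_is_complete P) (Fil_usual : usual_filtration P Fil)
    (T : R) (T_gt0 : 0 < T) (F : R -> (R -> Omega -> R) -> Omega -> R) :
  (class_C P Fil T F /\ functional_equation P Fil T F) <->
  (exists K : R -> R -> R,
     admissible_kernel T K /\ exp_integral_form P Fil T K F).
Proof.
split=> [[[h [h_cont h_na F_h]] F_eq]|[K [K_adm F_K]]].
  exists (functional_kernel T h); split.
    exact: (functional_kernel_admissible Fil_usual T_gt0 h_cont h_na F_h F_eq).
  exact: (functional_kernel_form Fil_usual T_gt0 h_cont h_na F_h F_eq).
split; first exact: (kernel_class_C Fil_usual T_gt0 K_adm F_K).
exact: (kernel_functional_equation Fil_usual T_gt0 K_adm F_K).
Qed.
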